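(* Let $\mathcal{M}=(\mathbb{R}^+\times\mathbb{R},\nabla)$ be a Type $\mathcal{B}$ surface model with $\dim\{\mathfrak{K}(\mathcal{M})\}=3$, and let $\mu\in\mathbb{R}$. Then $E(\mu,\nabla)=\{0\}$ except in the following cases, where ''$\mathcal{M}$ is $\mathcal{N}$'' means that $\mathcal{M}$ is linearly isomorphic to $\mathcal{N}$ and the solution space is the one of $\mathcal{N}$: (1) $\mu=0$ and $E(0,\nabla)=\operatorname{Span}\{1\}$. (2) $\mathcal{M}$ is $\mathcal{N}_3$, $\mu=-1$, and $E(-1,\nabla)=(x^1)^{-1}\operatorname{Span}\{1,\ x^2,\ (x^2)^2-(x^1)^2\}$. (3) $\mathcal{M}$ is $\mathcal{N}_4$, $\mu=-1$, and $E(-1,\nabla)=(x^1)^{-1}\operatorname{Span}\{1,\ x^2,\ (x^2)^2+(x^1)^2\}$. (4) $\mathcal{M}$ is $\mathcal{N}_1^{+}$ or $\mathcal{N}_1^-$, $\mu=-\frac14$, and $E(-\frac14,\nabla)=(x^1)^{-\frac12}\operatorname{Span}\{1,\ x^2\}$.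
   Context: For a torsion free connection $\nabla$ on a surface, with $\nabla_{\partial_{x^i}}\partial_{x^j}=\Gamma_{ij}{}^k\partial_{x^k}$, put $R(X,Y)=[\nabla_X,\nabla_Y]-\nabla_{[X,Y]}$, $\rho(X,Y)=\operatorname{Tr}\{Z\mapsto R(Z,X)Y\}$, and let $\rho_s$ be the symmetrization of $\rho$. The Hessian is $\mathcal{H}f=(\partial_{x^i}\partial_{x^j}f-\Gamma_{ij}{}^k\partial_{x^k}f)\,dx^i\otimes dx^j$, and for $\mu\in\mathbb{R}$, $E(\mu,\nabla)=\{f\in C^\infty: \mathcal{H}f=\mu f\rho_s\}$. $\mathfrak{K}(\mathcal{M})$ is the Lie algebra of affine Killing vector fields, i.e. vector fields $X$ with $\mathcal{L}_X\nabla=0$. A Type $\mathcal{B}$ surface model is $\mathbb{R}^+\times\mathbb{R}$ (coordinates $x^1>0$, $x^2$) with Christoffel symbols $\Gamma_{ij}{}^k=(x^1)^{-1}C_{ij}{}^k$, $C_{ij}{}^k=C_{ji}{}^k$ real constants. Two such models are linearly isomorphic if some map $(x^1,x^2)\mapsto(x^1,a\,x^1+b\,x^2)$ with $b\neq0$ intertwines the connections. Models (unlisted $C_{ij}{}^k$, apart from symmetry, are zero): $\mathcal{N}_1^\pm$: $C_{11}{}^1=-\frac32$, $C_{12}{}^2=-\frac12$, $C_{22}{}^1=\mp\frac12$. $\mathcal{N}_3$: $C_{11}{}^1=-1$, $C_{12}{}^2=-1$, $C_{22}{}^1=-1$ (Levi-Civita connection of $(x^1)^{-2}\{(dx^1)^2-(dx^2)^2\}$).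 $\mathcal{N}_4$: $C_{11}{}^1=-1$, $C_{12}{}^2=-1$, $C_{22}{}^1=1$ (Levi-Civita connection of $(x^1)^{-2}\{(dx^1)^2+(dx^2)^2\}$). The notation $g\operatorname{Span}\{h_1,\dots\}$ means $\operatorname{Span}\{gh_1,\dots\}$.
   Formalization: Case (1) is proved as ''μ=0 or ρ_s=0, and E(μ,∇)=Span{1}'': when ρ_s=0 (e.g. C_11^1=-3/2, C_12^1=1, C_12^2=-1/2, C_22^1=1/2, C_22^2=2) constants solve the equation for every μ, so E(μ,∇)≠{0} even for μ≠0. *)

(* Defs.v *)
From Stdlib Require Export Reals List.
From Coquelicot Require Export Coquelicot.
Open Scope R_scope.

(* Functions and vector fields on the half-plane {x^1 > 0} are represented by
   total functions of (x^1, x^2); only their values at points with x^1 > 0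
   matter, so smoothness and all identities are required there only. *)
Definition scalar_field : Type := R -> R -> R.

Inductive idx : Set := i1 | i2.

Definition sum2 (F : idx -> R) : R := F i1 + F i2.

Definition vector_field : Type := idx -> scalar_field.

Definition pd (i : idx) (f : scalar_field) : scalar_field :=
  match i with
  | i1 => fun x y => Derive (fun t => f t y) x
  | i2 => fun x y => Derive (fun t => f x t) y
  end.

Definition smooth (f : scalar_field) : Prop :=
  forall (n : nat) (x y : R), 0 < x -> ex_diff_n f n x y.

Definition smooth_vf (X : vector_field) : Prop := forall k, smooth (X k).

Definition coord_field (i : idx) : vector_field := fun k _ _ =>
  match i, k with i1, i1 | i2, i2 => 1 | _, _ => 0 end.

Definition dir_deriv (X : vector_field) (f : scalar_field) : scalar_field :=
  fun x y => sum2 (fun i => X i x y * pd i f x y).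

Definition bracket (X Y : vector_field) : vector_field :=
  fun k x y => dir_deriv X (Y k) x y - dir_deriv Y (X k) x y.

(* A connection is given by its Christoffel symbols: [G i j k] is
   Gamma_{ij}^k. *)
Definition christoffel : Type := idx -> idx -> idx -> scalar_field.

Definition nabla (G : christoffel) (X Y : vector_field) : vector_field :=
  fun k x y => dir_deriv X (Y k) x y
    + sum2 (fun i => sum2 (fun j => G i j k x y * X i x y * Y j x y)).

Definition curvature (G : christoffel) (X Y Z : vector_field) : vector_field :=
  fun k x y => nabla G X (nabla G Y Z) k x y - nabla G Y (nabla G X Z) k x y
    - nabla G (bracket X Y) Z k x y.

(* The trace of Z |-> R(Z,X)Y, computed in the coordinate frame. *)
Definition ricci (G : christoffel) (X Y : vector_field) : scalar_field :=
  fun x y => sum2 (fun i => curvature G (coord_field i) X Y i x y).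

Definition ricci_sym (G : christoffel) (X Y : vector_field) : scalar_field :=
  fun x y => (ricci G X Y x y + ricci G Y X x y) / 2.

(* If rho_s = 0, then E(mu, nabla) does not depend on mu.  This occurs for a
   non-flat Type B model with 3-dimensional Killing algebra: C_{11}^1 = -3/2,
   C_{12}^1 = 1, C_{12}^2 = -1/2, C_{22}^1 = 1/2, C_{22}^2 = 2 (others zero),
   whose Ricci tensor is skew-symmetric and non-zero. *)
Definition ricci_sym_zero (G : christoffel) : Prop :=
  forall X Y : vector_field, smooth_vf X -> smooth_vf Y ->
  forall x y : R, 0 < x -> ricci_sym G X Y x y = 0.

Definition hessian (G : christoffel) (f : scalar_field) (i j : idx) :
    scalar_field :=
  fun x y => pd i (pd j f) x y - sum2 (fun k => G i j k x y * pd k f x y).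

Definition qe_space (mu : R) (G : christoffel) (f : scalar_field) : Prop :=
  smooth f /\
  forall (i j : idx) (x y : R), 0 < x ->
    hessian G f i j x y
    = mu * f x y * ricci_sym G (coord_field i) (coord_field j) x y.

(* [L_X nabla = 0], where
   (L_X nabla)(Y,Z) = [X, nabla_Y Z] - nabla_[X,Y] Z - nabla_Y [X,Z]. *)
Definition affine_killing (G : christoffel) (X : vector_field) : Prop :=
  smooth_vf X /\
  forall Y Z : vector_field, smooth_vf Y -> smooth_vf Z ->
  forall (k : idx) (x y : R), 0 < x ->
    bracket X (nabla G Y Z) k x y
    - nabla G (bracket X Y) Z k x y - nabla G Y (bracket X Z) k x y = 0.

Definition rsum (n : nat) (F : nat -> R) : R :=
  fold_right Rplus 0 (map F (seq 0 n)).

Definition killing_dim (G : christoffel) (n : nat) : Prop :=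
  exists B : nat -> vector_field,
    (forall l, (l < n)%nat -> affine_killing G (B l)) /\
    (forall c : nat -> R,
      (forall (k : idx) (x y : R), 0 < x ->
        rsum n (fun l => c l * B l k x y) = 0) ->
      forall l, (l < n)%nat -> c l = 0) /\
    (forall X, affine_killing G X ->
      exists c : nat -> R, forall (k : idx) (x y : R), 0 < x ->
        X k x y = rsum n (fun l => c l * B l k x y)).

(* [Span g hs] is g Span{hs}. *)
Definition Span (g : scalar_field) (hs : list scalar_field)
    (f : scalar_field) : Prop :=
  exists c : nat -> R, forall x y : R, 0 < x ->
    f x y = rsum (length hs)
              (fun l => c l * (g x y * nth l hs (fun _ _ => 0) x y)).

Definition zero_space (f : scalar_field) : Prop :=
  forall x y : R, 0 < x -> f x y = 0.

Definition same_space (U V : scalar_field -> Prop) : Prop :=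
  forall f, U f <-> V f.

Definition typeB (C : idx -> idx -> idx -> R) : christoffel :=
  fun i j k x _ => / x * C i j k.

(* [vf_related a b X X']: X' is the push-forward of X under
   (x^1, x^2) |-> (x^1, a x^1 + b x^2). *)
Definition vf_related (a b : R) (X X' : vector_field) : Prop :=
  forall x y : R, 0 < x ->
    X' i1 x (a * x + b * y) = X i1 x y /\
    X' i2 x (a * x + b * y) = a * X i1 x y + b * X i2 x y.

Definition intertwines (a b : R) (G G' : christoffel) : Prop :=
  forall X Y X' Y' : vector_field,
    smooth_vf X -> smooth_vf Y -> smooth_vf X' -> smooth_vf Y' ->
    vf_related a b X X' -> vf_related a b Y Y' ->
    vf_related a b (nabla G X Y) (nabla G' X' Y').

Definition lin_iso (a b : R) (C C' : idx -> idx -> idx -> R) : Prop :=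
  b <> 0 /\ intertwines a b (typeB C) (typeB C').

Definition lin_isomorphic (C C' : idx -> idx -> idx -> R) : Prop :=
  exists a b : R, lin_iso a b C C'.

Definition pullback (a b : R) (V : scalar_field -> Prop) (f : scalar_field) :
    Prop :=
  exists g, V g /\ forall x y : R, 0 < x -> f x y = g x (a * x + b * y).

(* C_{11}^1 = p, C_{12}^2 = C_{21}^2 = q, C_{22}^1 = r, the others zero. *)
Definition diag_model (p q r : R) (i j k : idx) : R :=
  match i, j, k with
  | i1, i1, i1 => p
  | i1, i2, i2 | i2, i1, i2 => q
  | i2, i2, i1 => r
  | _, _, _ => 0
  end.

Definition N1_plus := diag_model (- (3 / 2)) (- (1 / 2)) (- (1 / 2)).
Definition N1_minus := diag_model (- (3 / 2)) (- (1 / 2)) (1 / 2).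
Definition N3 := diag_model (-1) (-1) (-1).
Definition N4 := diag_model (-1) (-1) 1.

Definition one_space : scalar_field -> Prop :=
  Span (fun _ _ => 1) ((fun _ _ => 1) :: nil).

Definition N1_space : scalar_field -> Prop :=
  Span (fun x _ => Rpower x (- (1 / 2)))
    ((fun _ _ => 1) :: (fun _ y => y) :: nil).

Definition N3_space : scalar_field -> Prop :=
  Span (fun x _ => / x)
    ((fun _ _ => 1) :: (fun _ y => y) :: (fun x y => y ^ 2 - x ^ 2) :: nil).

Definition N4_space : scalar_field -> Prop :=
  Span (fun x _ => / x)
    ((fun _ _ => 1) :: (fun _ y => y) :: (fun x y => y ^ 2 + x ^ 2) :: nil).

(* Main.v *)
From Stdlib Require Import Lra Lia FunctionalExtensionality.
Require Import Defs.

(** Write [E] for the Euler field [x d_x + y d_y].  Because the Christoffel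
    symbols are [C / x], the fields [d_y] and [E] are affine Killing for every
    [C], and brackets with them preserve the Killing algebra.  If that algebra
    has dimension 3 it is spanned by [d_y], [E] and one more field [X]; the
    Jacobi identity for [d_y], [E], [X] lets [X] be chosen with
    [d_y, X] = beta E and [E, X] = lambda X + gamma d_y, where lambda = 1 unless
    beta = 0 ([killing_graded_frame]).  All derivatives of [X] at the point
    (1, 0) up to order two are then explicit in beta, lambda, [X^1] and
    [d_x X^2], so that the Killing equations at this single point are polynomial
    equations in the constants [C] ([graded_jet_equations]).

    If beta = 0, these equations leave two families of models, and each of them
    has further Killing fields ([fiber_model_not_dim3],
    [affine_killing_flat_field]), so the dimension is larger than 3.  If
    beta <> 0, the Killing algebra is sl(2), replacing [y] by [y + c x] for a
    suitable [c] makes [X^1] proportional to [x y], and what remains, after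
    rescaling [y], is one of [N3], [N4], [N1_plus], [N1_minus] or a model
    [slant_model 1 r] ([killing_dim3_normal_form]).  Shears transport the spaces [qe_space]
    ([qe_space_shear]), so it suffices to solve the equation on these models.

    There the equation prescribes all second derivatives of [f].  Equating mixed
    third derivatives gives linear relations between [f], [d_x f] and [d_y f]
    ([slant_integrability], [metric_integrability]).  They force [f] to be
    constant unless mu = -1 on [N3], [N4] or mu = -1/4 on [N1_plus],
    [N1_minus]; in these cases multiplying [f] by [x], respectively by the square
    root of [x], leaves a system that integrates to polynomials.  Finally a
    constant [c] is a solution exactly when [mu rho_s c = 0]. *)

(** * Calculus on the half-plane *)

(** Sums and products of scalar fields are kept as named operations so that the
    rules for partial derivatives can be applied by rewriting, without
    unification under binders. *)
Definition fadd (f g : scalar_field) : scalar_field := fun x y => f x y + g x y.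

Definition fmul (f g : scalar_field) : scalar_field := fun x y => f x y * g x y.

Definition fconst (c : R) : scalar_field := fun _ _ => c.

Definition fshear (a b : R) (f : scalar_field) : scalar_field :=
  fun x y => f x (a * x + b * y).

Definition half_eq (f g : scalar_field) : Prop :=
  forall x y, 0 < x -> f x y = g x y.

(** Finite regularity is isolated because the closure properties of smooth fields
    are proved by induction on the order, and the derivative of a product or of
    a composite at order [n + 1] is a combination of fields of order [n]. *)
Definition Ck (n : nat) (f : scalar_field) : Prop :=
  forall x y, 0 < x -> ex_diff_n f n x y.

Lemma half_plane_open (P : R -> R -> Prop) (x y : R) :
  0 < x -> (forall u v, 0 < u -> P u v) -> locally_2d P x y.
Proof.
  intros Hx H. exists (mkposreal x Hx). intros u v Hu _. simpl in Hu.
  apply H. apply Rabs_def2 in Hu. lra.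
Qed.

Lemma half_line_open (P : R -> Prop) (x : R) :
  0 < x -> (forall u, 0 < u -> P u) -> locally x P.
Proof.
  intros Hx H. exists (mkposreal x Hx). intros u Hu.
  apply H. apply Rabs_def2 in Hu. simpl in Hu. unfold minus, plus, opp in Hu.
  simpl in Hu. lra.
Qed.

Lemma pd_ext (i : idx) (f g : scalar_field) :
  half_eq f g -> half_eq (pd i f) (pd i g).
Proof.
  intros H x y Hx. destruct i; simpl.
  - apply Derive_ext_loc, half_line_open; auto.
  - apply Derive_ext. intros t. now apply H.
Qed.

Lemma Ck_ext (n : nat) (f g : scalar_field) : half_eq f g -> Ck n f -> Ck n g.
Proof.
  intros H Hf x y Hx. apply ex_diff_n_ext_loc with f; auto.
  now apply half_plane_open.
Qed.

Lemma smooth_ext (f g : scalar_field) : half_eq f g -> smooth f -> smooth g.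
Proof. intros H Hf n. exact (Ck_ext n f g H (Hf n)). Qed.

Lemma Ck_le (m n : nat) (f : scalar_field) : (m <= n)%nat -> Ck n f -> Ck m f.
Proof. intros H Hf x y Hx. apply ex_diff_n_m with n; auto. Qed.

Lemma smooth_Ck (n : nat) (f : scalar_field) : smooth f -> Ck n f.
Proof. intros H. exact (H n). Qed.

Lemma Ck_pd (n : nat) (i : idx) (f : scalar_field) : Ck (S n) f -> Ck n (pd i f).
Proof. intros H x y Hx. destruct (H x y Hx) as (_ & _ & _ & H1 & H2).
  destruct i; assumption. Qed.

Lemma smooth_pd (i : idx) (f : scalar_field) : smooth f -> smooth (pd i f).
Proof. intros H n. apply Ck_pd. exact (H (S n)). Qed.

Lemma Ck_continuous (n : nat) (f : scalar_field) (x y : R) :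
  Ck n f -> 0 < x -> continuity_2d_pt f x y.
Proof. intros H Hx. destruct n; apply H; assumption. Qed.

Lemma Ck_derivable1 (n : nat) (f : scalar_field) (x y : R) :
  Ck (S n) f -> 0 < x -> ex_derive (fun t => f t y) x.
Proof. intros H Hx. apply (H x y Hx). Qed.

Lemma Ck_derivable2 (n : nat) (f : scalar_field) (x y : R) :
  Ck (S n) f -> 0 < x -> ex_derive (fun t => f x t) y.
Proof. intros H Hx. apply (H x y Hx). Qed.

Lemma Ck_succ (n : nat) (f : scalar_field) :
  (forall x y, 0 < x -> continuity_2d_pt f x y) ->
  (forall x y, 0 < x -> ex_derive (fun t => f t y) x) ->
  (forall x y, 0 < x -> ex_derive (fun t => f x t) y) ->
  (forall i, Ck n (pd i f)) -> Ck (S n) f.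
Proof.
  intros H0 H1 H2 H x y Hx. split; [auto|]. split; [auto|]. split; [auto|].
  split; [exact (H i1 x y Hx) | exact (H i2 x y Hx)].
Qed.

Lemma pd_add (i : idx) (f g : scalar_field) : Ck 1 f -> Ck 1 g ->
  half_eq (pd i (fadd f g)) (fadd (pd i f) (pd i g)).
Proof.
  intros Hf Hg x y Hx. destruct i; unfold fadd; simpl.
  - apply (Derive_plus (fun t => f t y) (fun t => g t y));
      eapply Ck_derivable1; eauto.
  - apply (Derive_plus (fun t => f x t) (fun t => g x t));
      eapply Ck_derivable2; eauto.
Qed.

Lemma pd_mul (i : idx) (f g : scalar_field) : Ck 1 f -> Ck 1 g ->
  half_eq (pd i (fmul f g)) (fadd (fmul (pd i f) g) (fmul f (pd i g))).
Proof.
  intros Hf Hg x y Hx. destruct i; unfold fadd, fmul; simpl.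
  - apply (Derive_mult (fun t => f t y) (fun t => g t y));
      eapply Ck_derivable1; eauto.
  - apply (Derive_mult (fun t => f x t) (fun t => g x t));
      eapply Ck_derivable2; eauto.
Qed.

Lemma pd_const (i : idx) (c x y : R) : pd i (fconst c) x y = 0.
Proof. destruct i; exact (Derive_const c _). Qed.

Lemma Ck_const (n : nat) (c : R) : Ck n (fconst c).
Proof.
  revert c. induction n as [|n IH]; intros c.
  - intros x y _. split; [apply continuity_2d_pt_const | exact I].
  - apply Ck_succ.
    + intros x y _. apply continuity_2d_pt_const.
    + intros x y _. exact (ex_derive_const c x).
    + intros x y _. exact (ex_derive_const c y).
    + intros i. apply Ck_ext with (fconst 0); [|apply IH].
      intros x y Hx. symmetry. apply pd_const.
Qed.

Lemma half_eq_sym (f g : scalar_field) : half_eq f g -> half_eq g f.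
Proof. intros H x y Hx. symmetry. auto. Qed.

Lemma Ck_add (n : nat) (f g : scalar_field) : Ck n f -> Ck n g -> Ck n (fadd f g).
Proof.
  revert f g. induction n as [|n IH]; intros f g Hf Hg.
  - intros x y Hx. split; [|exact I].
    apply continuity_2d_pt_plus; eapply Ck_continuous; eauto.
  - apply Ck_succ.
    + intros x y Hx. apply continuity_2d_pt_plus; eapply Ck_continuous; eauto.
    + intros x y Hx. apply (ex_derive_plus (fun t => f t y) (fun t => g t y));
        eapply Ck_derivable1; eauto.
    + intros x y Hx. apply (ex_derive_plus (fun t => f x t) (fun t => g x t));
        eapply Ck_derivable2; eauto.
    + intros i. eapply Ck_ext.
      * apply half_eq_sym, pd_add; apply (Ck_le 1 (S n)); auto; lia.
      * apply IH; now apply Ck_pd.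
Qed.

Lemma Ck_mul (n : nat) (f g : scalar_field) : Ck n f -> Ck n g -> Ck n (fmul f g).
Proof.
  revert f g. induction n as [|n IH]; intros f g Hf Hg.
  - intros x y Hx. split; [|exact I].
    apply continuity_2d_pt_mult; eapply Ck_continuous; eauto.
  - apply Ck_succ.
    + intros x y Hx. apply continuity_2d_pt_mult; eapply Ck_continuous; eauto.
    + intros x y Hx. apply (ex_derive_mult (fun t => f t y) (fun t => g t y));
        eapply Ck_derivable1; eauto.
    + intros x y Hx. apply (ex_derive_mult (fun t => f x t) (fun t => g x t));
        eapply Ck_derivable2; eauto.
    + intros i. eapply Ck_ext.
      * apply half_eq_sym, pd_mul; apply (Ck_le 1 (S n)); auto; lia.
      * apply Ck_add; apply IH; try (now apply Ck_pd); apply (Ck_le n (S n)); auto.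
Qed.

(** Continuity of one partial derivative near the point is what turns the two
    partial derivatives into a total one; the chain rule for shears needs it. *)
Lemma C1_differentiable (f : scalar_field) (x y : R) : Ck 1 f -> 0 < x ->
  differentiable_pt_lim f x y (pd i1 f x y) (pd i2 f x y).
Proof.
  intros Hf Hx. apply filterdiff_differentiable_pt_lim.
  apply (is_derive_filterdiff f x y (pd i1 f) (pd i2 f x y)).
  - apply (proj1 (locally_2d_locally
      (fun u v => is_derive (fun z => f z v) u (pd i1 f u v)) x y)).
    apply half_plane_open; auto. intros u v Hu.
    apply Derive_correct. eapply Ck_derivable1; eauto.
  - apply Derive_correct. eapply Ck_derivable2; eauto.
  - apply (proj1 (continuity_2d_pt_filterlim (pd i1 f) x y)).
    apply (Ck_continuous 0); auto. now apply Ck_pd.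
Qed.

Lemma shear_derive1 (a b : R) (f : scalar_field) (x y : R) : Ck 1 f -> 0 < x ->
  is_derive (fun t => fshear a b f t y) x
    (pd i1 f x (a * x + b * y) + a * pd i2 f x (a * x + b * y)).
Proof.
  intros Hf Hx. apply is_derive_Reals.
  replace (_ + _) with (pd i1 f x (a * x + b * y) * 1
    + pd i2 f x (a * x + b * y) * a) by ring.
  apply (derivable_pt_lim_comp_2d f (fun t => t) (fun t => a * t + b * y)).
  - now apply C1_differentiable.
  - apply derivable_pt_lim_id.
  - apply is_derive_Reals. auto_derive; auto. ring.
Qed.

Lemma shear_derive2 (a b : R) (f : scalar_field) (x y : R) : Ck 1 f -> 0 < x ->
  is_derive (fun t => fshear a b f x t) y (b * pd i2 f x (a * x + b * y)).
Proof.
  intros Hf Hx. apply is_derive_Reals.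
  replace (b * _) with (pd i1 f x (a * x + b * y) * 0
    + pd i2 f x (a * x + b * y) * b) by ring.
  apply (derivable_pt_lim_comp_2d f (fun t => x) (fun t => a * x + b * t)).
  - now apply C1_differentiable.
  - apply derivable_pt_lim_const.
  - apply is_derive_Reals. auto_derive; auto. ring.
Qed.

Lemma pd1_shear (a b : R) (f : scalar_field) : Ck 1 f ->
  half_eq (pd i1 (fshear a b f))
    (fadd (fshear a b (pd i1 f)) (fmul (fconst a) (fshear a b (pd i2 f)))).
Proof.
  intros Hf x y Hx. apply is_derive_unique. now apply shear_derive1.
Qed.

Lemma pd2_shear (a b : R) (f : scalar_field) : Ck 1 f ->
  half_eq (pd i2 (fshear a b f)) (fmul (fconst b) (fshear a b (pd i2 f))).
Proof.
  intros Hf x y Hx. apply is_derive_unique. now apply shear_derive2.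
Qed.

Lemma continuity_2d_shear (a b : R) (f : scalar_field) (x y : R) :
  continuity_2d_pt f x (a * x + b * y) -> continuity_2d_pt (fshear a b f) x y.
Proof.
  intros H. apply continuity_2d_pt_filterlim.
  apply continuity_2d_pt_filterlim in H.
  apply (continuous_comp_2 (fun z : R * R => fst z)
    (fun z : R * R => a * fst z + b * snd z) f (x, y)); [| |exact H].
  - apply continuous_fst.
  - apply (continuous_plus (fun z : R * R => a * fst z)
      (fun z : R * R => b * snd z)).
    + apply (continuous_mult (fun _ : R * R => a) (fun z : R * R => fst z));
        [apply continuous_const | apply continuous_fst].
    + apply (continuous_mult (fun _ : R * R => b) (fun z : R * R => snd z));
        [apply continuous_const | apply continuous_snd].
Qed.

Lemma Ck_shear (n : nat) (a b : R) (f : scalar_field) :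
  Ck n f -> Ck n (fshear a b f).
Proof.
  revert f. induction n as [|n IH]; intros f Hf.
  - intros x y Hx. split; [|exact I].
    apply continuity_2d_shear. eapply Ck_continuous; eauto.
  - assert (H1 : Ck 1 f) by (apply (Ck_le 1 (S n)); auto; lia).
    apply Ck_succ.
    + intros x y Hx. apply continuity_2d_shear. eapply Ck_continuous; eauto.
    + intros x y Hx. eexists. now apply shear_derive1.
    + intros x y Hx. eexists. now apply shear_derive2.
    + intros i. destruct i.
      * eapply Ck_ext; [apply half_eq_sym, pd1_shear; auto|].
        apply Ck_add; [|apply Ck_mul; [apply Ck_const|]];
          apply IH; now apply Ck_pd.
      * eapply Ck_ext; [apply half_eq_sym, pd2_shear; auto|].
        apply Ck_mul; [apply Ck_const | apply IH; now apply Ck_pd].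
Qed.

Lemma smooth_const (c : R) : smooth (fconst c).
Proof. intros n. exact (Ck_const n c). Qed.

Lemma smooth_add (f g : scalar_field) : smooth f -> smooth g -> smooth (fadd f g).
Proof. intros Hf Hg n. exact (Ck_add n f g (Hf n) (Hg n)). Qed.

Lemma smooth_mul (f g : scalar_field) : smooth f -> smooth g -> smooth (fmul f g).
Proof. intros Hf Hg n. exact (Ck_mul n f g (Hf n) (Hg n)). Qed.

Lemma smooth_shear (a b : R) (f : scalar_field) :
  smooth f -> smooth (fshear a b f).
Proof. intros Hf n. exact (Ck_shear n a b f (Hf n)). Qed.

(** Regularity is read off from the partial derivatives, which lets logarithms be
    reduced to powers of [x]. *)
Lemma smooth_of_partials (f f1 f2 : scalar_field) :
  (forall x y, 0 < x -> continuity_2d_pt f x y) ->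
  (forall x y, 0 < x -> is_derive (fun t => f t y) x (f1 x y)) ->
  (forall x y, 0 < x -> is_derive (fun t => f x t) y (f2 x y)) ->
  smooth f1 -> smooth f2 -> smooth f.
Proof.
  intros H0 H1 H2 S1 S2 n. apply (Ck_le n (S n)); [lia|]. apply Ck_succ; auto.
  - intros x y Hx. eexists. apply H1; auto.
  - intros x y Hx. eexists. apply H2; auto.
  - intros [|].
    + apply Ck_ext with f1; [|exact (S1 n)]. intros x y Hx. symmetry.
      apply is_derive_unique, H1; auto.
    + apply Ck_ext with f2; [|exact (S2 n)]. intros x y Hx. symmetry.
      apply is_derive_unique, H2; auto.
Qed.

Definition fun_of_x (g : R -> R) : scalar_field := fun x _ => g x.

Lemma continuity_fun_of_x (g : R -> R) (x y l : R) :
  is_derive g x l -> continuity_2d_pt (fun_of_x g) x y.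
Proof.
  intros H. apply (continuity_1d_2d_pt_comp g (fun u _ => u));
    [|apply continuity_2d_pt_id1].
  apply derivable_continuous_pt. exists l. now apply is_derive_Reals.
Qed.

Lemma smooth_fun_of_x (g g' : R -> R) :
  (forall x, 0 < x -> is_derive g x (g' x)) ->
  smooth (fun_of_x g') -> smooth (fun_of_x g).
Proof.
  intros H Hg. apply smooth_of_partials with (fun_of_x g') (fconst 0).
  - intros x y Hx. eapply continuity_fun_of_x; eauto.
  - intros x y Hx. exact (H x Hx).
  - intros x y _. exact (is_derive_const (g x) y).
  - exact Hg.
  - apply smooth_const.
Qed.

Lemma is_derive_Rpower (c x : R) : 0 < x ->
  is_derive (fun t => Rpower t c) x (c * Rpower x (c - 1)).
Proof. intros Hx. apply is_derive_Reals. now apply derivable_pt_lim_power. Qed.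

(** The family of all real powers, up to constants, is closed under
    differentiation; hence the induction is over all exponents at once. *)
Lemma smooth_Rpower (c : R) : smooth (fun_of_x (fun x => Rpower x c)).
Proof.
  intros n. revert c. induction n as [|n IH]; intros c.
  - intros x y Hx. split; [|exact I].
    eapply continuity_fun_of_x, is_derive_Rpower; auto.
  - apply Ck_succ.
    + intros x y Hx. eapply continuity_fun_of_x, is_derive_Rpower; auto.
    + intros x y Hx. eexists. now apply is_derive_Rpower.
    + intros x y Hx. exact (ex_derive_const (Rpower x c) y).
    + intros [|].
      * apply Ck_ext with
          (fmul (fconst c) (fun_of_x (fun x => Rpower x (c - 1)))).
        -- intros x y Hx. symmetry. now apply is_derive_unique, is_derive_Rpower.
        -- apply Ck_mul; [apply Ck_const | exact (IH (c - 1))].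
      * apply Ck_ext with (fconst 0); [|apply Ck_const].
        intros x y _. symmetry. exact (Derive_const (Rpower x c) y).
Qed.

Lemma smooth_inv : smooth (fun_of_x Rinv).
Proof.
  apply smooth_ext with (fun_of_x (fun x => Rpower x (- 1)));
    [|apply smooth_Rpower].
  intros x y Hx. unfold fun_of_x.
  replace (- 1) with (- (1)) by lra. rewrite Rpower_Ropp, Rpower_1; auto.
Qed.

Lemma smooth_ln : smooth (fun_of_x ln).
Proof.
  apply smooth_fun_of_x with Rinv; [|apply smooth_inv].
  intros x Hx. apply is_derive_Reals.
  now apply derivable_pt_lim_ln.
Qed.

Definition coord_x : scalar_field := fun x _ => x.

Definition coord_y : scalar_field := fun _ y => y.

Lemma smooth_coord_x : smooth coord_x.
Proof.
  apply (smooth_fun_of_x (fun x => x) (fun _ => 1)).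
  - intros x _. exact (is_derive_id x).
  - apply smooth_const.
Qed.

Lemma smooth_coord_y : smooth coord_y.
Proof.
  apply smooth_of_partials with (fconst 0) (fconst 1); try apply smooth_const.
  - intros x y _. apply continuity_2d_pt_id2.
  - intros x y _. exact (is_derive_const y x).
  - intros x y _. exact (is_derive_id y).
Qed.

Lemma smooth_derivable1 (f : scalar_field) (x y : R) :
  smooth f -> 0 < x -> ex_derive (fun t => f t y) x.
Proof. intros Hf. apply (Ck_derivable1 0). exact (Hf 1%nat). Qed.

Lemma smooth_derivable2 (f : scalar_field) (x y : R) :
  smooth f -> 0 < x -> ex_derive (fun t => f x t) y.
Proof. intros Hf. apply (Ck_derivable2 0). exact (Hf 1%nat). Qed.

Lemma smooth_continuous (f : scalar_field) (x y : R) :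
  smooth f -> 0 < x -> continuity_2d_pt f x y.
Proof. intros Hf. apply (Ck_continuous 0). exact (Hf 0%nat). Qed.

Lemma pd_comm (f : scalar_field) : smooth f ->
  half_eq (pd i1 (pd i2 f)) (pd i2 (pd i1 f)).
Proof.
  intros Hf x y Hx.
  assert (S1 := smooth_pd i1 f Hf). assert (S2 := smooth_pd i2 f Hf).
  apply (Schwarz f x y).
  - apply half_plane_open; auto. intros u v Hu.
    split; [now apply smooth_derivable1|].
    split; [now apply smooth_derivable2|].
    split; [now apply (smooth_derivable1 (pd i2 f))
           |now apply (smooth_derivable2 (pd i1 f))].
  - apply (smooth_continuous (pd i1 (pd i2 f))); auto. now apply smooth_pd.
  - apply (smooth_continuous (pd i2 (pd i1 f))); auto. now apply smooth_pd.
Qed.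

(** The half-plane is connected by vertical and horizontal segments, and the mean
    value theorem applies on each. *)
Lemma half_plane_constant (f : scalar_field) : smooth f ->
  (forall i, half_eq (pd i f) (fconst 0)) -> half_eq f (fconst (f 1 0)).
Proof.
  intros Hf H x y Hx. unfold fconst.
  assert (Hy : f x y = f x 0).
  { destruct (MVT_gen (fun t => f x t) 0 y (fun t => pd i2 f x t)) as [c [_ Hc]].
    - intros t _. now apply Derive_correct, smooth_derivable2.
    - intros t _. apply derivable_continuous_pt, ex_derive_Reals_0.
      now apply smooth_derivable2.
    - rewrite (H i2 x c Hx) in Hc. unfold fconst in Hc. lra. }
  assert (H1 : forall t, Rmin 1 x <= t -> 0 < t).
  { intros t. unfold Rmin. destruct (Rle_dec 1 x); lra. }
  destruct (MVT_gen (fun t => f t 0) 1 x (fun t => pd i1 f t 0)) as [c [Hc1 Hc]].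
  - intros t Ht. apply Derive_correct, smooth_derivable1; auto. apply H1; lra.
  - intros t Ht. apply derivable_continuous_pt, ex_derive_Reals_0.
    apply smooth_derivable1; auto. apply H1; lra.
  - rewrite (H i1 c 0) in Hc; [|apply H1; lra]. unfold fconst in Hc. lra.
Qed.

Lemma pd_smooth_add (i : idx) (f g : scalar_field) (x y : R) :
  smooth f -> smooth g -> 0 < x ->
  pd i (fadd f g) x y = pd i f x y + pd i g x y.
Proof. intros Hf Hg Hx. exact (pd_add i f g (Hf 1%nat) (Hg 1%nat) x y Hx). Qed.

Lemma pd_smooth_mul (i : idx) (f g : scalar_field) (x y : R) :
  smooth f -> smooth g -> 0 < x ->
  pd i (fmul f g) x y = pd i f x y * g x y + f x y * pd i g x y.
Proof. intros Hf Hg Hx. exact (pd_mul i f g (Hf 1%nat) (Hg 1%nat) x y Hx). Qed.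

#[export] Hint Resolve smooth_const smooth_add smooth_mul smooth_pd
  smooth_coord_x smooth_coord_y smooth_Rpower smooth_inv smooth_ln : smooth.

Lemma pd1_coord_x (x y : R) : pd i1 coord_x x y = 1.
Proof. exact (Derive_id x). Qed.

Lemma pd2_coord_x (x y : R) : pd i2 coord_x x y = 0.
Proof. exact (Derive_const x y). Qed.

Lemma pd1_coord_y (x y : R) : pd i1 coord_y x y = 0.
Proof. exact (Derive_const y x). Qed.

Lemma pd2_coord_y (x y : R) : pd i2 coord_y x y = 1.
Proof. exact (Derive_id y). Qed.

Ltac pd_push :=
  repeat first
    [ rewrite pd_smooth_add by auto 20 with smooth
    | rewrite pd_smooth_mul by auto 20 with smooth ];
  rewrite ?pd_const, ?pd1_coord_x, ?pd2_coord_x, ?pd1_coord_y, ?pd2_coord_y.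

Lemma pd2_fun_of_x (g : R -> R) (x y : R) : pd i2 (fun_of_x g) x y = 0.
Proof. exact (Derive_const (g x) y). Qed.

Lemma pd1_fun_of_x (g : R -> R) (x y l : R) :
  is_derive g x l -> pd i1 (fun_of_x g) x y = l.
Proof. exact (is_derive_unique g x l). Qed.

Lemma pd1_inv (x y : R) : 0 < x ->
  pd i1 (fun_of_x Rinv) x y = - (/ x * / x).
Proof. intros Hx. apply pd1_fun_of_x. auto_derive; [lra | field; lra]. Qed.

(** * Tensor formulas for smooth connections *)

Definition smooth_connection (G : christoffel) : Prop :=
  forall i j k, smooth (G i j k).

Lemma smooth_coord_field (i : idx) : smooth_vf (coord_field i).
Proof. intros k. destruct i, k; apply smooth_const. Qed.

Lemma pd_coord_field (i j k : idx) (x y : R) : pd i (coord_field j k) x y = 0.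
Proof. destruct i, j, k; exact (Derive_const _ _). Qed.

Lemma pd_nabla (G : christoffel) (X Y : vector_field) (l k : idx) (x y : R) :
  smooth_connection G -> smooth_vf X -> smooth_vf Y -> 0 < x ->
  pd l (nabla G X Y k) x y =
  sum2 (fun i => pd l (X i) x y * pd i (Y k) x y
                 + X i x y * pd l (pd i (Y k)) x y)
  + sum2 (fun i => sum2 (fun j =>
      pd l (G i j k) x y * X i x y * Y j x y
      + G i j k x y * (pd l (X i) x y * Y j x y + X i x y * pd l (Y j) x y))).
Proof.
  intros HG HX HY Hx.
  set (d := fun i => fmul (X i) (pd i (Y k))).
  set (t := fun i j => fmul (fmul (G i j k) (X i)) (Y j)).
  assert (Hd : forall i, smooth (d i)).
  { intros i. apply smooth_mul; [apply HX | apply smooth_pd, HY]. }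
  assert (Ht : forall i j, smooth (t i j)).
  { intros i j. repeat apply smooth_mul; [apply HG | apply HX | apply HY]. }
  change (nabla G X Y k) with
    (fadd (fadd (d i1) (d i2))
      (fadd (fadd (t i1 i1) (t i1 i2)) (fadd (t i2 i1) (t i2 i2)))).
  rewrite !pd_smooth_add by auto with smooth.
  assert (Ed : forall i, pd l (d i) x y = pd l (X i) x y * pd i (Y k) x y
                 + X i x y * pd l (pd i (Y k)) x y).
  { intros i. unfold d. now rewrite pd_smooth_mul by auto with smooth. }
  assert (Et : forall i j, pd l (t i j) x y =
      pd l (G i j k) x y * X i x y * Y j x y
      + G i j k x y * (pd l (X i) x y * Y j x y + X i x y * pd l (Y j) x y)).
  { intros i j. unfold t. rewrite !pd_smooth_mul by auto with smooth.
    unfold fmul. ring. }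
  rewrite !Ed, !Et. reflexivity.
Qed.

Lemma pd_bracket (X Y : vector_field) (l k : idx) (x y : R) :
  smooth_vf X -> smooth_vf Y -> 0 < x ->
  pd l (bracket X Y k) x y =
  sum2 (fun i => pd l (X i) x y * pd i (Y k) x y
                 + X i x y * pd l (pd i (Y k)) x y
                 - pd l (Y i) x y * pd i (X k) x y
                 - Y i x y * pd l (pd i (X k)) x y).
Proof.
  intros HX HY Hx.
  set (d := fun (X Y : vector_field) i => fmul (X i) (pd i (Y k))).
  assert (Hd : forall X Y, smooth_vf X -> smooth_vf Y -> forall i, smooth (d X Y i)).
  { intros A B HA HB i. apply smooth_mul; [apply HA | apply smooth_pd, HB]. }
  assert (Ed : forall X Y, smooth_vf X -> smooth_vf Y -> forall i,
    pd l (d X Y i) x y = pd l (X i) x y * pd i (Y k) x y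
                 + X i x y * pd l (pd i (Y k)) x y).
  { intros A B HA HB i. unfold d. now rewrite pd_smooth_mul by auto with smooth. }
  assert (E : half_eq (bracket X Y k)
    (fadd (fadd (d X Y i1) (d X Y i2))
      (fmul (fconst (-1)) (fadd (d Y X i1) (d Y X i2))))).
  { intros u v _. unfold bracket, dir_deriv, sum2, d, fadd, fmul, fconst. ring. }
  rewrite (pd_ext l _ _ E x y Hx).
  rewrite pd_smooth_add, pd_smooth_mul, !pd_smooth_add, pd_const, !Ed
    by auto with smooth.
  unfold sum2, fconst, fadd. ring.
Qed.

(** The components of [L_X nabla]. *)
Definition killing_op (G : christoffel) (X : vector_field) (i j k : idx) :
    scalar_field :=
  fun x y => pd i (pd j (X k)) x y
    + sum2 (fun l => X l x y * pd l (G i j k) x y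
                     + G l j k x y * pd i (X l) x y
                     + G i l k x y * pd j (X l) x y
                     - G i j l x y * pd l (X k) x y).

(** The Lie derivative of a connection is a tensor: all terms with derivatives of
    [Y] or [Z] cancel, those with second derivatives of [Z] by the symmetry of
    mixed partial derivatives. *)
Lemma lie_derivative_nabla (G : christoffel) (X Y Z : vector_field)
    (k : idx) (x y : R) :
  smooth_connection G -> smooth_vf X -> smooth_vf Y -> smooth_vf Z -> 0 < x ->
  bracket X (nabla G Y Z) k x y
    - nabla G (bracket X Y) Z k x y - nabla G Y (bracket X Z) k x y
  = sum2 (fun i => sum2 (fun j =>
      killing_op G X i j k x y * Y i x y * Z j x y)).
Proof.
  intros HG HX HY HZ Hx.
  unfold bracket at 1, dir_deriv, nabla at 3 4, dir_deriv.
  unfold sum2.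
  rewrite !pd_nabla, !pd_bracket; auto.
  unfold killing_op, nabla, bracket, dir_deriv, sum2.
  rewrite !(pd_comm _ (HX k) x y Hx), !(pd_comm _ (HZ k) x y Hx).
  ring.
Qed.

(** Tensoriality reduces the condition to coordinate fields, which makes it a
    linear system of partial differential equations for [X]. *)
Lemma affine_killing_iff (G : christoffel) (X : vector_field) :
  smooth_connection G ->
  affine_killing G X <->
  smooth_vf X /\
  forall i j k x y, 0 < x -> killing_op G X i j k x y = 0.
Proof.
  intros HG. split; intros [HX H]; split; auto.
  - intros i j k x y Hx.
    assert (E := H (coord_field i) (coord_field j) (smooth_coord_field i)
      (smooth_coord_field j) k x y Hx).
    rewrite lie_derivative_nabla in E; auto using smooth_coord_field.
    rewrite <- E. destruct i, j; unfold sum2, coord_field; ring.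
  - intros Y Z HY HZ k x y Hx.
    rewrite lie_derivative_nabla; auto.
    unfold sum2. rewrite !H; auto. ring.
Qed.

(** [riemann G i j l k] is the [k]-component of R(d_i, d_j) d_l. *)
Definition riemann (G : christoffel) (i j l k : idx) : scalar_field :=
  fun x y => pd i (G j l k) x y - pd j (G i l k) x y
    + sum2 (fun m => G i m k x y * G j l m x y - G j m k x y * G i l m x y).

(** Needed for arbitrary fields, because the vanishing of the symmetrized Ricci
    tensor is a condition on all pairs of smooth fields. *)
Lemma curvature_components (G : christoffel) (X Y Z : vector_field)
    (k : idx) (x y : R) :
  smooth_connection G -> smooth_vf X -> smooth_vf Y -> smooth_vf Z -> 0 < x ->
  curvature G X Y Z k x y =
  sum2 (fun i => sum2 (fun j => sum2 (fun l =>
    riemann G i j l k x y * X i x y * Y j x y * Z l x y))).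
Proof.
  intros HG HX HY HZ Hx.
  unfold curvature. unfold nabla at 1 3 5. unfold dir_deriv, sum2.
  rewrite !pd_nabla; auto.
  unfold riemann, nabla, bracket, dir_deriv, sum2.
  rewrite !(pd_comm _ (HZ k) x y Hx).
  ring.
Qed.

Definition ricci_tensor (G : christoffel) (j l : idx) : scalar_field :=
  fun x y => sum2 (fun i => riemann G i j l i x y).

Lemma ricci_components (G : christoffel) (X Y : vector_field) (x y : R) :
  smooth_connection G -> smooth_vf X -> smooth_vf Y -> 0 < x ->
  ricci G X Y x y =
  sum2 (fun j => sum2 (fun l => ricci_tensor G j l x y * X j x y * Y l x y)).
Proof.
  intros HG HX HY Hx. unfold ricci, ricci_tensor. unfold sum2 at 1.
  rewrite !curvature_components; auto using smooth_coord_field.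
  unfold sum2, coord_field. ring.
Qed.

(** * Type B connections *)

Lemma is_derive_inv_scaled (c x : R) : 0 < x ->
  is_derive (fun t => / t * c) x (- c / x ^ 2).
Proof. intros Hx. auto_derive; [lra | field; lra]. Qed.

Lemma smooth_typeB (C : idx -> idx -> idx -> R) : smooth_connection (typeB C).
Proof.
  intros i j k.
  change (smooth (fmul (fun_of_x Rinv) (fconst (C i j k)))). auto with smooth.
Qed.

Lemma pd1_typeB (C : idx -> idx -> idx -> R) (i j k : idx) (x y : R) :
  0 < x -> pd i1 (typeB C i j k) x y = - C i j k / x ^ 2.
Proof. intros Hx. now apply is_derive_unique, is_derive_inv_scaled. Qed.

Lemma pd2_typeB (C : idx -> idx -> idx -> R) (i j k : idx) (x y : R) :
  pd i2 (typeB C i j k) x y = 0.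
Proof. exact (Derive_const _ _). Qed.

(** The system [killing_op = 0] for Christoffel symbols [C / x], cleared of
    denominators. *)
Definition killing_eq (C : idx -> idx -> idx -> R) (X : vector_field) : Prop :=
  forall i j k x y, 0 < x ->
    x ^ 2 * pd i (pd j (X k)) x y - X i1 x y * C i j k
    + x * sum2 (fun l => C l j k * pd i (X l) x y + C i l k * pd j (X l) x y
                         - C i j l * pd l (X k) x y) = 0.

Lemma affine_killing_typeB (C : idx -> idx -> idx -> R) (X : vector_field) :
  affine_killing (typeB C) X <-> smooth_vf X /\ killing_eq C X.
Proof.
  rewrite affine_killing_iff by apply smooth_typeB.
  assert (E : forall i j k x y, 0 < x ->
    x ^ 2 * killing_op (typeB C) X i j k x y =
    x ^ 2 * pd i (pd j (X k)) x y - X i1 x y * C i j k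
    + x * sum2 (fun l => C l j k * pd i (X l) x y + C i l k * pd j (X l) x y
                         - C i j l * pd l (X k) x y)).
  { intros i j k x y Hx. unfold killing_op, sum2.
    rewrite pd1_typeB, pd2_typeB by assumption. unfold typeB. field. lra. }
  split; intros [HX H]; split; auto; intros i j k x y Hx.
  - rewrite <- E, H by assumption. ring.
  - apply Rmult_eq_reg_l with (x ^ 2); [|apply pow_nonzero; lra].
    rewrite E by assumption. rewrite (H i j k x y Hx). ring.
Qed.

(** [ricci_const C j l] is [x^2] times the component [rho_jl]. *)
Definition ricci_const (C : idx -> idx -> idx -> R) (j l : idx) : R :=
  sum2 (fun i =>
    match i with i1 => - C j l i | i2 => 0 end
    + match j with i1 => C i l i | i2 => 0 end
    + sum2 (fun m => C i m i * C j l m - C j m i * C i l m)).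

Definition ricci_sym_const (C : idx -> idx -> idx -> R) (j l : idx) : R :=
  (ricci_const C j l + ricci_const C l j) / 2.

Lemma ricci_tensor_typeB (C : idx -> idx -> idx -> R) (j l : idx) (x y : R) :
  0 < x -> ricci_tensor (typeB C) j l x y = ricci_const C j l / x ^ 2.
Proof.
  intros Hx. unfold ricci_tensor, riemann, ricci_const, sum2.
  destruct j; rewrite ?pd1_typeB, ?pd2_typeB by assumption; unfold typeB;
    field; lra.
Qed.

Lemma ricci_sym_typeB (C : idx -> idx -> idx -> R) (X Y : vector_field)
    (x y : R) : smooth_vf X -> smooth_vf Y -> 0 < x ->
  ricci_sym (typeB C) X Y x y =
  sum2 (fun j => sum2 (fun l =>
    ricci_sym_const C j l * X j x y * Y l x y)) / x ^ 2.
Proof.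
  intros HX HY Hx. unfold ricci_sym.
  rewrite !ricci_components by auto using smooth_typeB.
  unfold sum2 at 1 2 3 4 5 6. rewrite !ricci_tensor_typeB by assumption.
  unfold sum2, ricci_sym_const. field. lra.
Qed.

Lemma ricci_sym_coord (C : idx -> idx -> idx -> R) (i j : idx) (x y : R) :
  0 < x -> ricci_sym (typeB C) (coord_field i) (coord_field j) x y
    = ricci_sym_const C i j / x ^ 2.
Proof.
  intros Hx. rewrite ricci_sym_typeB by auto using smooth_coord_field.
  destruct i, j; unfold sum2, coord_field; field; lra.
Qed.

Lemma ricci_sym_zero_typeB (C : idx -> idx -> idx -> R) :
  ricci_sym_zero (typeB C) <-> forall i j, ricci_sym_const C i j = 0.
Proof.
  split; intros H.
  - intros i j.
    assert (E := H _ _ (smooth_coord_field i) (smooth_coord_field j) 1 0 Rlt_0_1).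
    rewrite ricci_sym_coord in E by lra. lra.
  - intros X Y HX HY x y Hx. rewrite ricci_sym_typeB by assumption.
    unfold sum2. rewrite !H. field. lra.
Qed.

(** The equation [H f = mu f rho_s], multiplied by [x ^ 2]. *)
Definition quasi_einstein (mu : R) (C : idx -> idx -> idx -> R)
    (f : scalar_field) : Prop :=
  forall i j x y, 0 < x ->
    x ^ 2 * pd i (pd j f) x y
    = x * sum2 (fun k => C i j k * pd k f x y)
      + mu * ricci_sym_const C i j * f x y.

Lemma qe_space_typeB (mu : R) (C : idx -> idx -> idx -> R) (f : scalar_field) :
  qe_space mu (typeB C) f <-> smooth f /\ quasi_einstein mu C f.
Proof.
  split; intros [Hf H]; split; auto; intros i j x y Hx.
  - assert (E := H i j x y Hx). rewrite ricci_sym_coord in E by assumption.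
    unfold hessian, typeB, sum2 in *.
    replace (pd i (pd j f) x y) with (/ x * C i j i1 * pd i1 f x y
      + / x * C i j i2 * pd i2 f x y
      + mu * f x y * (ricci_sym_const C i j / x ^ 2)) by lra.
    field. lra.
  - rewrite ricci_sym_coord by assumption. unfold hessian, typeB.
    assert (E := H i j x y Hx). unfold sum2 in *.
    apply Rmult_eq_reg_l with (x ^ 2); [|apply pow_nonzero; lra].
    rewrite Rmult_minus_distr_l, E. field. lra.
Qed.

(** * Shears *)

(** The Jacobian matrix of [(x, y) |-> (x, a x + b y)]. *)
Definition shear_jac (a b : R) (i m : idx) : R :=
  match i, m with
  | i1, i1 => 1 | i1, i2 => a | i2, i1 => 0 | i2, i2 => b
  end.

Definition shear_pull (a b : R) (D : idx -> idx -> idx -> R) (i j k : idx) : R :=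
  sum2 (fun m => sum2 (fun n => shear_jac a b i m * shear_jac a b j n * D m n k)).

(** The Christoffel symbols [C / x] are the pull-back of [D / x] under
    [(x, y) |-> (x, a x + b y)].  The second equation is the transformation law
    of the upper index [i2], solved for [C i j i2]. *)
Definition shear_related (a b : R) (C D : idx -> idx -> idx -> R) : Prop :=
  forall i j, C i j i1 = shear_pull a b D i j i1 /\
              C i j i2 = (shear_pull a b D i j i2 - a * C i j i1) / b.

(** In one direction the intertwining property is tested on coordinate fields and
    their push-forwards, which have constant components; in the other it follows
    from the chain rule. *)
Lemma lin_iso_shear_related (a b : R) (C D : idx -> idx -> idx -> R) :
  lin_iso a b C D <-> b <> 0 /\ shear_related a b C D.
Proof.
  split; intros [Hb H]; split; auto.
  - intros i j.
    set (push := fun i : idx => (fun m => fconst (shear_jac a b i m)) : vector_field).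
    assert (Hpush : forall i, smooth_vf (push i)) by (intros l m; apply smooth_const).
    assert (R1 : forall i, vf_related a b (coord_field i) (push i)).
    { intros l x y _. unfold push, fconst.
      destruct l; unfold coord_field, shear_jac; split; ring. }
    destruct (H (coord_field i) (coord_field j) (push i) (push j)
      (smooth_coord_field i) (smooth_coord_field j) (Hpush i) (Hpush j)
      (R1 i) (R1 j) 1 0 Rlt_0_1) as [E1 E2].
    unfold nabla, dir_deriv, sum2 in E1, E2.
    rewrite !pd_coord_field in E1.
    rewrite !(pd_coord_field _ j i1), !(pd_coord_field _ j i2) in E2.
    unfold push in E1, E2.
    rewrite !pd_const in E1, E2. unfold fconst, typeB in E1, E2.
    rewrite Rinv_1 in E1, E2. unfold shear_pull, sum2.
    assert (E : C i j i1 = shear_jac a b i i1 * shear_jac a b j i1 * D i1 i1 i1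
      + shear_jac a b i i1 * shear_jac a b j i2 * D i1 i2 i1
      + (shear_jac a b i i2 * shear_jac a b j i1 * D i2 i1 i1
      + shear_jac a b i i2 * shear_jac a b j i2 * D i2 i2 i1)).
    { destruct i, j; unfold coord_field, shear_jac in *; lra. }
    split; [exact E|]. apply Rmult_eq_reg_l with b; [|exact Hb].
    match goal with |- _ = b * ((?s - ?t) / b) =>
      replace (b * ((s - t) / b)) with (s - t) by (field; exact Hb) end.
    destruct i, j; unfold coord_field, shear_jac in *; lra.
  - intros X Y X' Y' HX HY HX' HY' RX RY.
    intros x y Hx.
    destruct (RX x y Hx) as [X1 X2]. destruct (RY x y Hx) as [Y1 Y2].
    assert (HY1 : half_eq (Y i1) (fshear a b (Y' i1))).
    { intros u v Hu. symmetry. now apply RY. }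
    assert (HY2 : half_eq (fadd (fmul (fconst a) (Y i1)) (fmul (fconst b) (Y i2)))
                          (fshear a b (Y' i2))).
    { intros u v Hu. symmetry. now apply RY. }
    assert (P1 := fun i => pd_ext i _ _ HY1 x y Hx).
    assert (P2 := fun i => pd_ext i _ _ HY2 x y Hx).
    assert (P1x := P1 i1). assert (P1y := P1 i2).
    assert (P2x := P2 i1). assert (P2y := P2 i2).
    rewrite pd_smooth_add, !pd_smooth_mul, !pd_const in P2x, P2y
      by auto with smooth.
    rewrite pd1_shear in P1x, P2x by (auto using smooth_Ck).
    rewrite pd2_shear in P1y, P2y by (auto using smooth_Ck).
    unfold fadd, fmul, fconst, fshear in *.
    assert (Q2x : pd i1 (Y i2) x y = (pd i1 (Y' i2) x (a * x + b * y)
      + a * pd i2 (Y' i2) x (a * x + b * y) - a * pd i1 (Y i1) x y) / b)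
      by (rewrite <- P2x; field; auto).
    assert (Q2y : pd i2 (Y i2) x y = (b * pd i2 (Y' i2) x (a * x + b * y)
      - a * pd i2 (Y i1) x y) / b)
      by (rewrite <- P2y; field; auto).
    unfold nabla, dir_deriv, typeB, sum2.
    rewrite X1, X2, Y1, Y2, Q2x, Q2y, P1x, P1y.
    rewrite !(proj2 (H _ _)), !(proj1 (H _ _)).
    unfold shear_pull, shear_jac, sum2. split; field; lra.
Qed.

Lemma ricci_sym_const_shear (a b : R) (C D : idx -> idx -> idx -> R) (i j : idx) :
  b <> 0 -> shear_related a b C D ->
  ricci_sym_const C i j = sum2 (fun m => sum2 (fun n =>
    shear_jac a b i m * shear_jac a b j n * ricci_sym_const D m n)).
Proof.
  intros Hb H. unfold ricci_sym_const, ricci_const, sum2.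
  rewrite !(proj2 (H _ _)), !(proj1 (H _ _)).
  unfold shear_pull, sum2.
  destruct i, j; unfold shear_jac; field; auto.
Qed.

Lemma quasi_einstein_shear (mu a b : R) (C D : idx -> idx -> idx -> R)
    (g : scalar_field) :
  b <> 0 -> shear_related a b C D -> smooth g ->
  quasi_einstein mu D g -> quasi_einstein mu C (fshear a b g).
Proof.
  intros Hb HCD Hg H i j x y Hx. unfold sum2.
  assert (E1 : half_eq (pd i1 (fshear a b g))
    (fadd (fshear a b (pd i1 g)) (fmul (fconst a) (fshear a b (pd i2 g)))))
    by now apply pd1_shear, smooth_Ck.
  assert (E2 : half_eq (pd i2 (fshear a b g))
    (fmul (fconst b) (fshear a b (pd i2 g))))
    by now apply pd2_shear, smooth_Ck.
  assert (F : forall i, pd i (pd j (fshear a b g)) x y =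
    sum2 (fun m => sum2 (fun n => shear_jac a b i m * shear_jac a b j n
                                  * pd m (pd n g) x (a * x + b * y)))).
  { intros l.
    assert (D1 : forall h, smooth h -> pd l (fshear a b h) x y =
      sum2 (fun m => shear_jac a b l m * pd m h x (a * x + b * y))).
    { intros h Hh. destruct l.
      - rewrite (pd1_shear a b h) by auto using smooth_Ck.
        unfold fadd, fmul, fconst, fshear, sum2, shear_jac. ring.
      - rewrite (pd2_shear a b h) by auto using smooth_Ck.
        unfold fadd, fmul, fconst, fshear, sum2, shear_jac. ring. }
    destruct j.
    - rewrite (pd_ext l _ _ E1 x y Hx).
      rewrite pd_smooth_add, pd_smooth_mul, pd_const, !D1
        by auto using smooth_shear with smooth.
      unfold sum2, fconst, shear_jac. ring.
    - rewrite (pd_ext l _ _ E2 x y Hx).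
      rewrite pd_smooth_mul, pd_const, !D1
        by auto using smooth_shear with smooth.
      unfold sum2, fconst, shear_jac. ring. }
  rewrite F, (E1 x y Hx), (E2 x y Hx).
  rewrite (ricci_sym_const_shear a b C D) by assumption.
  unfold fadd, fmul, fconst, fshear, sum2.
  assert (K := fun m n => H m n x (a * x + b * y) Hx).
  assert (K' : forall m n, pd m (pd n g) x (a * x + b * y) =
    (x * sum2 (fun k => D m n k * pd k g x (a * x + b * y))
      + mu * ricci_sym_const D m n * g x (a * x + b * y)) / x ^ 2).
  { intros m n. rewrite <- K. field. lra. }
  rewrite !K', !(proj2 (HCD _ _)), !(proj1 (HCD _ _)).
  unfold shear_pull, sum2.
  destruct i, j; unfold shear_jac; field; lra.
Qed.

(** * The Killing algebra *)

Lemma pd_swap (i j : idx) (f : scalar_field) : smooth f ->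
  half_eq (pd i (pd j f)) (pd j (pd i f)).
Proof.
  intros Hf x y Hx. destruct i, j; auto.
  - now apply pd_comm.
  - symmetry. now apply pd_comm.
Qed.

Lemma pd_swap3 (l i j : idx) (f : scalar_field) : smooth f ->
  half_eq (pd l (pd i (pd j f))) (pd i (pd j (pd l f))).
Proof.
  intros Hf x y Hx. rewrite (pd_swap l i) by auto with smooth.
  apply pd_ext; auto. now apply pd_swap.
Qed.

Definition euler_field : vector_field := fun k =>
  match k with i1 => coord_x | i2 => coord_y end.

Definition euler_deriv (f : scalar_field) : scalar_field :=
  fadd (fmul coord_x (pd i1 f)) (fmul coord_y (pd i2 f)).

(** The bracket of the Euler field with [X]. *)
Definition euler_bracket (X : vector_field) : vector_field := fun k =>
  fadd (euler_deriv (X k)) (fmul (fconst (-1)) (X k)).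

Lemma smooth_euler_deriv (f : scalar_field) : smooth f -> smooth (euler_deriv f).
Proof. intros Hf. unfold euler_deriv. auto with smooth. Qed.

#[export] Hint Resolve smooth_euler_deriv : smooth.

Lemma pd_euler_deriv (i : idx) (f : scalar_field) : smooth f ->
  half_eq (pd i (euler_deriv f)) (fadd (euler_deriv (pd i f)) (pd i f)).
Proof.
  intros Hf x y Hx. unfold euler_deriv at 1. destruct i; pd_push;
    unfold euler_deriv, fadd, fmul.
  - rewrite (pd_comm f Hf x y Hx). ring.
  - rewrite (pd_comm f Hf x y Hx). ring.
Qed.

Lemma pd_euler_bracket (i k : idx) (X : vector_field) : smooth_vf X ->
  half_eq (pd i (euler_bracket X k)) (euler_deriv (pd i (X k))).
Proof.
  intros HX x y Hx. unfold euler_bracket. pd_push.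
  rewrite pd_euler_deriv by auto. unfold fadd, fconst. ring.
Qed.

Lemma pd2_euler_bracket (i j k : idx) (X : vector_field) : smooth_vf X ->
  half_eq (pd i (pd j (euler_bracket X k)))
    (fadd (euler_deriv (pd i (pd j (X k)))) (pd i (pd j (X k)))).
Proof.
  intros HX x y Hx. rewrite (pd_ext i _ _ (pd_euler_bracket j k X HX) x y Hx).
  apply pd_euler_deriv; auto. apply smooth_pd, HX.
Qed.

(** The left-hand side of [killing_eq] as a scalar field, so that the equation can
    be differentiated. *)
Definition killing_lhs (C : idx -> idx -> idx -> R) (X : vector_field)
    (i j k : idx) : scalar_field :=
  let s l := fadd (fadd (fmul (fconst (C l j k)) (pd i (X l)))
                        (fmul (fconst (C i l k)) (pd j (X l))))
                  (fmul (fconst (- C i j l)) (pd l (X k))) in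
  fadd (fadd (fmul (fmul coord_x coord_x) (pd i (pd j (X k))))
             (fmul (fconst (- C i j k)) (X i1)))
       (fmul coord_x (fadd (s i1) (s i2))).

Lemma killing_eq_lhs (C : idx -> idx -> idx -> R) (X : vector_field) :
  killing_eq C X <-> forall i j k, half_eq (killing_lhs C X i j k) (fconst 0).
Proof.
  assert (E : forall i j k x y, killing_lhs C X i j k x y =
    x ^ 2 * pd i (pd j (X k)) x y - X i1 x y * C i j k
    + x * sum2 (fun l => C l j k * pd i (X l) x y + C i l k * pd j (X l) x y
                         - C i j l * pd l (X k) x y)).
  { intros. unfold killing_lhs, fadd, fmul, fconst, coord_x, sum2. ring. }
  split; intros H i j k x y Hx.
  - rewrite E. now apply H.
  - rewrite <- E. now apply H.
Qed.

(** The coefficients of the system do not depend on [y], so it commutes with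
    [d_y]. *)
Lemma killing_eq_pd2 (C : idx -> idx -> idx -> R) (X : vector_field) :
  smooth_vf X -> killing_eq C X -> killing_eq C (fun k => pd i2 (X k)).
Proof.
  intros HX H. apply killing_eq_lhs. intros i j k x y Hx.
  rewrite killing_eq_lhs in H.
  assert (E := pd_ext i2 _ _ (H i j k) x y Hx). rewrite pd_const in E.
  rewrite <- E. unfold killing_lhs at 2. cbv zeta. pd_push.
  rewrite !(pd_swap3 i2) by auto.
  rewrite !(pd_swap i2 i), !(pd_swap i2 j), !(pd_swap i2 i1) by auto with smooth.
  unfold killing_lhs, fadd, fmul, fconst, coord_x. ring.
Qed.

(** The system is homogeneous under dilations: if [K] denotes its left-hand side,
    then [K ([E, X]) = E (K X) - K X]. *)
Lemma killing_eq_euler_bracket (C : idx -> idx -> idx -> R) (X : vector_field) :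
  smooth_vf X -> killing_eq C X -> killing_eq C (euler_bracket X).
Proof.
  intros HX H. apply killing_eq_lhs. intros i j k x y Hx.
  rewrite killing_eq_lhs in H.
  assert (E0 := H i j k x y Hx).
  assert (E1 := pd_ext i1 _ _ (H i j k) x y Hx). rewrite pd_const in E1.
  assert (E2 := pd_ext i2 _ _ (H i j k) x y Hx). rewrite pd_const in E2.
  unfold fconst in E0.
  transitivity (x * pd i1 (killing_lhs C X i j k) x y
    + y * pd i2 (killing_lhs C X i j k) x y - killing_lhs C X i j k x y);
    [|unfold fconst; rewrite E0, E1, E2; ring].
  clear E0 E1 E2.
  unfold killing_lhs at 2 3. cbv zeta. pd_push.
  unfold killing_lhs, fadd, fmul.
  rewrite (pd2_euler_bracket i j k X HX x y Hx).
  rewrite !(pd_euler_bracket i _ X HX x y Hx), !(pd_euler_bracket j _ X HX x y Hx),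
    !(pd_euler_bracket i1 _ X HX x y Hx), !(pd_euler_bracket i2 _ X HX x y Hx).
  unfold euler_bracket, euler_deriv, fadd, fmul, fconst, coord_x, coord_y. ring.
Qed.

Lemma smooth_euler_field : smooth_vf euler_field.
Proof. intros [|]; simpl; auto with smooth. Qed.

Lemma pd_euler_field (i k : idx) :
  half_eq (pd i (euler_field k)) (fconst (match i, k with
    | i1, i1 | i2, i2 => 1 | _, _ => 0 end)).
Proof.
  intros x y _. destruct i, k; unfold euler_field, fconst.
  - apply pd1_coord_x.
  - apply pd1_coord_y.
  - apply pd2_coord_x.
  - apply pd2_coord_y.
Qed.

Lemma affine_killing_coord2 (C : idx -> idx -> idx -> R) :
  affine_killing (typeB C) (coord_field i2).
Proof.
  apply affine_killing_typeB. split; [apply smooth_coord_field|].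
  intros i j k x y Hx. unfold sum2.
  assert (E : pd i (pd j (coord_field i2 k)) x y = 0).
  { rewrite (pd_ext i _ (fconst 0)); auto; [apply pd_const|].
    intros u v _. apply pd_coord_field. }
  rewrite E, !pd_coord_field. unfold coord_field. ring.
Qed.

Lemma affine_killing_euler (C : idx -> idx -> idx -> R) :
  affine_killing (typeB C) euler_field.
Proof.
  apply affine_killing_typeB. split; [apply smooth_euler_field|].
  intros i j k x y Hx. unfold sum2.
  rewrite (pd_ext i _ _ (pd_euler_field j k) x y Hx), pd_const.
  rewrite !(pd_euler_field _ _ x y Hx).
  unfold euler_field, coord_x, fconst. destruct i, j, k; ring.
Qed.

Definition killing_span (X Y : vector_field) : Prop :=
  exists c d m : R, forall k x y, 0 < x ->
    Y k x y = c * coord_field i2 k x y + d * euler_field k x y + m * X k x y.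

(** A basis of the Killing algebra can be chosen to contain [d_y] and [E]: these
    two are independent, so they replace two of the three basis fields. *)
Lemma killing_frame (C : idx -> idx -> idx -> R) :
  killing_dim (typeB C) 3 ->
  exists X, affine_killing (typeB C) X /\
    (forall c d : R, ~ forall k x y, 0 < x ->
       X k x y = c * coord_field i2 k x y + d * euler_field k x y) /\
    forall Y, affine_killing (typeB C) Y -> killing_span X Y.
Proof.
  intros (B & HB & Hind & Hspan).
  assert (Sp : forall Y, affine_killing (typeB C) Y -> exists c : nat -> R,
    forall k x y, 0 < x -> Y k x y =
      c 0%nat * B 0%nat k x y + c 1%nat * B 1%nat k x y + c 2%nat * B 2%nat k x y).
  { intros Y HY. destruct (Hspan Y HY) as [c Hc]. exists c.
    intros k x y Hx. rewrite (Hc k x y Hx). unfold rsum. simpl. ring. }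
  assert (In : forall c0 c1 c2 : R, (forall k x y, 0 < x ->
      c0 * B 0%nat k x y + c1 * B 1%nat k x y + c2 * B 2%nat k x y = 0) ->
      c0 = 0 /\ c1 = 0 /\ c2 = 0).
  { intros c0 c1 c2 H.
    assert (Z := Hind (fun l => match l with 0%nat => c0 | 1%nat => c1 | _ => c2 end)).
    assert (Z' : forall l, (l < 3)%nat ->
      match l with 0%nat => c0 | 1%nat => c1 | _ => c2 end = 0).
    { apply Z. intros k x y Hx. unfold rsum. simpl. assert (K := H k x y Hx). lra. }
    repeat split; [apply (Z' 0%nat) | apply (Z' 1%nat) | apply (Z' 2%nat)]; lia. }
  destruct (Sp _ (affine_killing_coord2 C)) as [a Ha].
  destruct (Sp _ (affine_killing_euler C)) as [b Hb].
  (* The three fields are the basis in some order: [S] is kept and [P], [Q] are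
     traded for [d_y] and the Euler field. *)
  assert (Pick : forall (P Q S : vector_field) (a0 a1 a2 b0 b1 b2 : R),
    affine_killing (typeB C) S ->
    (forall c0 c1 c2 : R, (forall k x y, 0 < x ->
      c0 * P k x y + c1 * Q k x y + c2 * S k x y = 0) ->
      c0 = 0 /\ c1 = 0 /\ c2 = 0) ->
    (forall Y, affine_killing (typeB C) Y -> exists c0 c1 c2,
      forall k x y, 0 < x -> Y k x y = c0 * P k x y + c1 * Q k x y + c2 * S k x y) ->
    (forall k x y, 0 < x -> coord_field i2 k x y
       = a0 * P k x y + a1 * Q k x y + a2 * S k x y) ->
    (forall k x y, 0 < x -> euler_field k x y
       = b0 * P k x y + b1 * Q k x y + b2 * S k x y) ->
    a0 * b1 - a1 * b0 <> 0 ->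
    exists X, affine_killing (typeB C) X /\
    (forall c d : R, ~ forall k x y, 0 < x ->
       X k x y = c * coord_field i2 k x y + d * euler_field k x y) /\
    forall Y, affine_killing (typeB C) Y -> killing_span X Y).
  { intros P Q S a0 a1 a2 b0 b1 b2 HS HI HSp He HE Hdet.
    exists S. split; [exact HS|]. split.
    - intros c d H.
      destruct (HI (c * a0 + d * b0) (c * a1 + d * b1) (c * a2 + d * b2 - 1))
        as (Z0 & Z1 & Z2).
      { intros k x y Hx. assert (K := H k x y Hx).
        rewrite (He k x y Hx), (HE k x y Hx) in K. lra. }
      assert (Hc : c = 0).
      { apply Rmult_eq_reg_r with (a0 * b1 - a1 * b0); auto.
        replace (c * (a0 * b1 - a1 * b0)) with
          ((c * a0 + d * b0) * b1 - (c * a1 + d * b1) * b0) by ring.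
        rewrite Z0, Z1. ring. }
      assert (Hd : d = 0).
      { apply Rmult_eq_reg_r with (a0 * b1 - a1 * b0); auto.
        replace (d * (a0 * b1 - a1 * b0)) with
          ((c * a1 + d * b1) * a0 - (c * a0 + d * b0) * a1) by ring.
        rewrite Z0, Z1. ring. }
      rewrite Hc, Hd in Z2. lra.
    - intros Y HY. destruct (HSp Y HY) as (c0 & c1 & c2 & HYc).
      set (D := a0 * b1 - a1 * b0) in *.
      exists ((c0 * b1 - c1 * b0) / D), ((c1 * a0 - c0 * a1) / D),
        (c2 - (c0 * (a2 * b1 - a1 * b2) + c1 * (a0 * b2 - a2 * b0)) / D).
      intros k x y Hx. rewrite (HYc k x y Hx), (He k x y Hx), (HE k x y Hx).
      unfold D in *. field. auto. }
  set (a0 := a 0%nat) in *. set (a1 := a 1%nat) in *. set (a2 := a 2%nat) in *.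
  set (b0 := b 0%nat) in *. set (b1 := b 1%nat) in *. set (b2 := b 2%nat) in *.
  destruct (Req_dec (a0 * b1 - a1 * b0) 0) as [D01|D01].
  2: { apply (Pick (B 0%nat) (B 1%nat) (B 2%nat) a0 a1 a2 b0 b1 b2); auto.
       intros Y HY. destruct (Sp Y HY) as [c Hc]. eauto. }
  destruct (Req_dec (a0 * b2 - a2 * b0) 0) as [D02|D02].
  2: { apply (Pick (B 0%nat) (B 2%nat) (B 1%nat) a0 a2 a1 b0 b2 b1); auto.
       - intros c0 c1 c2 H. destruct (In c0 c2 c1) as (? & ? & ?); auto.
         intros k x y Hx. assert (K := H k x y Hx). lra.
       - intros Y HY. destruct (Sp Y HY) as [c Hc].
         exists (c 0%nat), (c 2%nat), (c 1%nat). intros k x y Hx.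
         rewrite (Hc k x y Hx). ring.
       - intros k x y Hx. rewrite (Ha k x y Hx). ring.
       - intros k x y Hx. rewrite (Hb k x y Hx). ring. }
  destruct (Req_dec (a1 * b2 - a2 * b1) 0) as [D12|D12].
  2: { apply (Pick (B 1%nat) (B 2%nat) (B 0%nat) a1 a2 a0 b1 b2 b0); auto.
       - intros c0 c1 c2 H. destruct (In c2 c0 c1) as (? & ? & ?); auto.
         intros k x y Hx. assert (K := H k x y Hx). lra.
       - intros Y HY. destruct (Sp Y HY) as [c Hc].
         exists (c 1%nat), (c 2%nat), (c 0%nat). intros k x y Hx.
         rewrite (Hc k x y Hx). ring.
       - intros k x y Hx. rewrite (Ha k x y Hx). ring.
       - intros k x y Hx. rewrite (Hb k x y Hx). ring. }
  (* All minors vanish: then [b_j d_y = a_j E] for every [j], which forces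
     [a = 0]. *)
  exfalso.
  assert (Z : forall u v : R,
    (forall k x y, 0 < x -> u * coord_field i2 k x y = v * euler_field k x y) ->
    v = 0).
  { intros u v H. assert (K := H i1 1 0 Rlt_0_1).
    unfold coord_field, euler_field, coord_x in K. lra. }
  assert (Za0 : a0 = 0).
  { apply (Z b0). intros k x y Hx. rewrite (Ha k x y Hx), (Hb k x y Hx).
    replace (b0 * _) with ((a0 * b0) * B 0%nat k x y + (a1 * b0) * B 1%nat k x y
      + (a2 * b0) * B 2%nat k x y) by ring.
    replace (a1 * b0) with (a0 * b1) by lra.
    replace (a2 * b0) with (a0 * b2) by lra. ring. }
  assert (Za1 : a1 = 0).
  { apply (Z b1). intros k x y Hx. rewrite (Ha k x y Hx), (Hb k x y Hx).
    replace (b1 * _) with ((a0 * b1) * B 0%nat k x y + (a1 * b1) * B 1%nat k x y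
      + (a2 * b1) * B 2%nat k x y) by ring.
    replace (a0 * b1) with (a1 * b0) by lra.
    replace (a2 * b1) with (a1 * b2) by lra. ring. }
  assert (Za2 : a2 = 0).
  { apply (Z b2). intros k x y Hx. rewrite (Ha k x y Hx), (Hb k x y Hx).
    replace (b2 * _) with ((a0 * b2) * B 0%nat k x y + (a1 * b2) * B 1%nat k x y
      + (a2 * b2) * B 2%nat k x y) by ring.
    replace (a0 * b2) with (a2 * b0) by lra.
    replace (a1 * b2) with (a2 * b1) by lra. ring. }
  assert (K := Ha i2 1 0 Rlt_0_1). rewrite Za0, Za1, Za2 in K.
  unfold coord_field in K. lra.
Qed.

Definition vf_comb (a c : R) (X Y : vector_field) : vector_field := fun k =>
  fadd (fmul (fconst a) (X k)) (fmul (fconst c) (Y k)).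

Lemma smooth_vf_comb (a c : R) (X Y : vector_field) :
  smooth_vf X -> smooth_vf Y -> smooth_vf (vf_comb a c X Y).
Proof. intros HX HY k. unfold vf_comb. auto with smooth. Qed.

Lemma pd_vf_comb (i k : idx) (a c : R) (X Y : vector_field) :
  smooth_vf X -> smooth_vf Y ->
  half_eq (pd i (vf_comb a c X Y k))
    (fadd (fmul (fconst a) (pd i (X k))) (fmul (fconst c) (pd i (Y k)))).
Proof.
  intros HX HY x y Hx. unfold vf_comb. pd_push. unfold fadd, fmul, fconst. ring.
Qed.

Lemma killing_eq_comb (C : idx -> idx -> idx -> R) (a c : R) (X Y : vector_field) :
  smooth_vf X -> smooth_vf Y -> killing_eq C X -> killing_eq C Y ->
  killing_eq C (vf_comb a c X Y).
Proof.
  intros HX HY EX EY i j k x y Hx.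
  rewrite (pd_ext i _ _ (pd_vf_comb j k a c X Y HX HY) x y Hx). pd_push.
  unfold sum2. rewrite !(pd_vf_comb _ _ a c X Y HX HY x y Hx).
  assert (KX := EX i j k x y Hx). assert (KY := EY i j k x y Hx).
  unfold vf_comb, fadd, fmul, fconst, sum2 in *.
  match type of KX with ?s = 0 => match type of KY with ?t = 0 =>
    transitivity (a * s + c * t); [ring | rewrite KX, KY; ring] end end.
Qed.

(** The bracket relations [d_y, X] = beta E and [E, X] = lambda X + gamma d_y. *)
Record graded_field (X : vector_field) (beta lambda gamma : R) : Prop := {
  graded_smooth : smooth_vf X;
  graded_y1 : half_eq (pd i2 (X i1)) (fmul (fconst beta) coord_x);
  graded_y2 : half_eq (pd i2 (X i2)) (fmul (fconst beta) coord_y);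
  graded_euler1 : half_eq (euler_bracket X i1) (fmul (fconst lambda) (X i1));
  graded_euler2 : half_eq (euler_bracket X i2)
    (fadd (fmul (fconst lambda) (X i2)) (fconst gamma)) }.

(** On the quotient of the Killing algebra by the span of [d_y] and [E], the
    field [d_y] acts trivially, because it is a commutator of these two fields.
    So [d_y X] has no [X]-part; its [d_y]-part is removed by subtracting a
    multiple of [E] from [X], and the rest of the Jacobi identity reads
    lambda beta = beta. *)
Lemma killing_graded_frame (C : idx -> idx -> idx -> R) :
  killing_dim (typeB C) 3 ->
  exists X beta lambda gamma,
    killing_eq C X /\ graded_field X beta lambda gamma /\
    (beta <> 0 -> lambda = 1) /\
    (forall c d : R, ~ forall k x y, 0 < x ->
       X k x y = c * coord_field i2 k x y + d * euler_field k x y) /\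
    (forall Y, affine_killing (typeB C) Y -> killing_span X Y).
Proof.
  intros Hdim. destruct (killing_frame C Hdim) as (X & KX & Hind & Hspan).
  apply affine_killing_typeB in KX. destruct KX as [HX KX].
  assert (H2 : smooth_vf (fun k => pd i2 (X k))) by (intros k; apply smooth_pd, HX).
  assert (HE : smooth_vf (euler_bracket X))
    by (intros k; unfold euler_bracket; auto with smooth).
  destruct (Hspan (fun k => pd i2 (X k))) as (al & be & ka & Hy).
  { apply affine_killing_typeB. split; auto. now apply killing_eq_pd2. }
  destruct (Hspan (euler_bracket X)) as (ga & de & la & He).
  { apply affine_killing_typeB. split; auto. now apply killing_eq_euler_bracket. }
  assert (Hy1 : half_eq (pd i2 (X i1))
    (fadd (fmul (fconst be) coord_x) (fmul (fconst ka) (X i1)))).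
  { intros x y Hx. rewrite (Hy i1 x y Hx).
    unfold coord_field, euler_field, fadd, fmul, fconst. ring. }
  assert (Hy2 : half_eq (pd i2 (X i2))
    (fadd (fadd (fconst al) (fmul (fconst be) coord_y)) (fmul (fconst ka) (X i2)))).
  { intros x y Hx. rewrite (Hy i2 x y Hx).
    unfold coord_field, euler_field, fadd, fmul, fconst. ring. }
  assert (He1 : half_eq (euler_bracket X i1)
    (fadd (fmul (fconst de) coord_x) (fmul (fconst la) (X i1)))).
  { intros x y Hx. rewrite (He i1 x y Hx).
    unfold coord_field, euler_field, fadd, fmul, fconst. ring. }
  assert (He2 : half_eq (euler_bracket X i2)
    (fadd (fadd (fconst ga) (fmul (fconst de) coord_y)) (fmul (fconst la) (X i2)))).
  { intros x y Hx. rewrite (He i2 x y Hx).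
    unfold coord_field, euler_field, fadd, fmul, fconst. ring. }
  (* The Jacobi identity [d_y [E, X] = [E, d_y X] + d_y X], with both brackets
     expressed in the frame. *)
  assert (J : forall x y, 0 < x ->
    ka * X i1 x y = (la * be - be - ka * de) * x /\
    ka * X i2 x y = (de + la * al - ka * ga) + (la * be - be - ka * de) * y).
  { intros x y Hx.
    assert (A1 := pd_ext i2 _ _ He1 x y Hx).
    assert (A2 := pd_ext i2 _ _ He2 x y Hx).
    rewrite pd_euler_bracket in A1, A2 by auto.
    unfold euler_deriv, fadd, fmul in A1, A2.
    rewrite (pd_ext i1 _ _ Hy1 x y Hx), (pd_ext i2 _ _ Hy1 x y Hx) in A1.
    rewrite (pd_ext i1 _ _ Hy2 x y Hx), (pd_ext i2 _ _ Hy2 x y Hx) in A2.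
    change (fun x y => fconst de x y * coord_x x y + fconst la x y * X i1 x y)
      with (fadd (fmul (fconst de) coord_x) (fmul (fconst la) (X i1))) in A1.
    change (fun x y => fconst ga x y + fconst de x y * coord_y x y
       + fconst la x y * X i2 x y)
      with (fadd (fadd (fconst ga) (fmul (fconst de) coord_y))
              (fmul (fconst la) (X i2))) in A2.
    revert A1 A2. pd_push. rewrite (Hy1 x y Hx), (Hy2 x y Hx). intros A1 A2.
    assert (B1 := He1 x y Hx). assert (B2 := He2 x y Hx).
    unfold euler_bracket, euler_deriv in B1, B2.
    unfold fadd, fmul, fconst, coord_x, coord_y in *.
    rewrite (Hy1 x y Hx) in B1. rewrite (Hy2 x y Hx) in B2.
    unfold fadd, fmul, fconst, coord_x, coord_y in *.
    apply (f_equal (Rmult ka)) in B1. apply (f_equal (Rmult ka)) in B2.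
    split; lra. }
  assert (Hka : ka = 0).
  { destruct (Req_dec ka 0) as [E|N]; auto. exfalso.
    apply (Hind ((de + la * al - ka * ga) / ka) ((la * be - be - ka * de) / ka)).
    intros k x y Hx. destruct (J x y Hx) as [J1 J2].
    apply Rmult_eq_reg_l with ka; auto.
    destruct k; unfold coord_field, euler_field, coord_x, coord_y.
    - rewrite J1. field. auto.
    - rewrite J2. field. auto. }
  destruct (J 1 0 Rlt_0_1) as [J1 J2]. rewrite Hka in J1, J2.
  assert (Hde : de = - (la * al)) by lra.
  set (X' := vf_comb 1 (- al) X euler_field).
  assert (HX' : smooth_vf X') by (apply smooth_vf_comb; auto; apply smooth_euler_field).
  exists X', be, la, ga. repeat split.
  - apply killing_eq_comb; auto; [apply smooth_euler_field|].
    apply affine_killing_typeB, affine_killing_euler.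
  - exact HX'.
  - intros x y Hx. unfold X'. rewrite pd_vf_comb; auto using smooth_euler_field.
    unfold fadd, fmul. rewrite (Hy1 x y Hx), (pd_euler_field _ _ x y Hx).
    unfold fadd, fmul, fconst. rewrite Hka. ring.
  - intros x y Hx. unfold X'. rewrite pd_vf_comb; auto using smooth_euler_field.
    unfold fadd, fmul. rewrite (Hy2 x y Hx), (pd_euler_field _ _ x y Hx).
    unfold fadd, fmul, fconst. rewrite Hka. ring.
  - intros x y Hx. assert (B := He1 x y Hx).
    unfold euler_bracket, euler_deriv, fadd, fmul in B |- *.
    unfold X'. rewrite !(pd_vf_comb _ _ _ _ _ _ HX smooth_euler_field x y Hx).
    unfold fadd, fmul. rewrite !(pd_euler_field _ _ x y Hx).
    unfold vf_comb, fadd, fmul, fconst, euler_field, coord_x, coord_y in *.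
    rewrite Hde in B. lra.
  - intros x y Hx. assert (B := He2 x y Hx).
    unfold euler_bracket, euler_deriv, fadd, fmul in B |- *.
    unfold X'. rewrite !(pd_vf_comb _ _ _ _ _ _ HX smooth_euler_field x y Hx).
    unfold fadd, fmul. rewrite !(pd_euler_field _ _ x y Hx).
    unfold vf_comb, fadd, fmul, fconst, euler_field, coord_x, coord_y in *.
    rewrite Hde in B. lra.
  - intros Hbe. apply Rmult_eq_reg_r with be; auto. lra.
  - intros c d H. apply (Hind c (d + al)). intros k x y Hx.
    assert (K := H k x y Hx). unfold X', vf_comb, fadd, fmul, fconst in K. lra.
  - intros Y HY. destruct (Hspan Y HY) as (c & d & m & E).
    exists c, (d + m * al), m. intros k x y Hx. rewrite (E k x y Hx).
    unfold X', vf_comb, fadd, fmul, fconst. ring.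
Qed.

(** [F] times [x ^ (- a)] is constant. *)
Lemma homogeneous_vanishes (F : scalar_field) (a : R) : smooth F ->
  half_eq (pd i2 F) (fconst 0) ->
  half_eq (fmul coord_x (pd i1 F)) (fmul (fconst a) F) ->
  F 1 0 = 0 -> half_eq F (fconst 0).
Proof.
  intros HF H2 H1 H0.
  set (P := fun_of_x (fun x => Rpower x (- a))).
  assert (HP : smooth P) by apply smooth_Rpower.
  assert (D1 : forall x y, 0 < x -> pd i1 P x y = - a * Rpower x (- a - 1)).
  { intros x y Hx. now apply pd1_fun_of_x, is_derive_Rpower. }
  assert (D2 : forall x y, pd i2 P x y = 0) by apply pd2_fun_of_x.
  assert (K : half_eq (fmul F P) (fconst (fmul F P 1 0))).
  { apply half_plane_constant; [auto with smooth|]. intros i x y Hx.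
    rewrite pd_smooth_mul by auto. destruct i.
    - rewrite D1 by auto. assert (E := H1 x y Hx).
      unfold fmul, fconst, coord_x in E. unfold P, fun_of_x.
      replace (Rpower x (- a)) with (x * Rpower x (- a - 1)).
      + unfold fconst. replace (pd i1 F x y * _) with
          (x * pd i1 F x y * Rpower x (- a - 1)) by ring. rewrite E. ring.
      + rewrite <- (Rpower_1 x) at 1 by auto. rewrite <- Rpower_plus.
        f_equal. ring.
    - rewrite D2, (H2 x y Hx). unfold fconst. ring. }
  intros x y Hx. assert (E := K x y Hx).
  unfold fmul, fconst, P, fun_of_x in E. rewrite H0, Rmult_0_l in E.
  assert (Q : 0 < Rpower x (- a)) by apply exp_pos.
  apply Rmult_integral in E. unfold fconst. destruct E; lra.
Qed.

(** The Killing equations of a graded field at the point [(1, 0)], in terms of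
    [f = X^1], [h = d_x X^2] there and the degree [a = lambda + 1]. *)
Record jet_equations (C : idx -> idx -> idx -> R) (f h a be : R) : Prop := {
  jet111 : a * (a - 1) * f - f * C i1 i1 i1
    + 2 * (C i1 i1 i1 * (a * f) + C i1 i2 i1 * h)
    - C i1 i1 i1 * (a * f) - C i1 i1 i2 * be = 0;
  jet112 : (a - 1) * h - f * C i1 i1 i2
    + 2 * (C i1 i1 i2 * (a * f) + C i1 i2 i2 * h) - C i1 i1 i1 * h = 0;
  jet121 : be - f * C i1 i2 i1 + C i2 i2 i1 * h + C i1 i1 i1 * be
    - C i1 i2 i2 * be = 0;
  jet122 : - f * C i1 i2 i2 + C i1 i2 i2 * (a * f) + C i2 i2 i2 * h
    + C i1 i1 i2 * be - C i1 i2 i1 * h = 0;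
  jet221 : - f * C i2 i2 i1 + 2 * (C i1 i2 i1 * be) - C i2 i2 i1 * (a * f)
    - C i2 i2 i2 * be = 0;
  jet222 : be - f * C i2 i2 i2 + 2 * (C i1 i2 i2 * be) - C i2 i2 i1 * h = 0 }.

Lemma graded_jet_equations (C : idx -> idx -> idx -> R) (X : vector_field)
    (be la ga : R) : (forall i j k, C i j k = C j i k) ->
  killing_eq C X -> graded_field X be la ga ->
  jet_equations C (X i1 1 0) (pd i1 (X i2) 1 0) (1 + la) be.
Proof.
  intros HC HK [HX Hy1 Hy2 He1 He2].
  assert (V11 : pd i1 (X i1) 1 0 = (1 + la) * X i1 1 0).
  { assert (E := He1 1 0 Rlt_0_1).
    unfold euler_bracket, euler_deriv, fadd, fmul, fconst, coord_x, coord_y in E.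
    lra. }
  assert (V21 : pd i2 (X i1) 1 0 = be).
  { rewrite (Hy1 1 0 Rlt_0_1). unfold fmul, fconst, coord_x. ring. }
  assert (V22 : pd i2 (X i2) 1 0 = 0).
  { rewrite (Hy2 1 0 Rlt_0_1). unfold fmul, fconst, coord_y. ring. }
  assert (W111 : pd i1 (pd i1 (X i1)) 1 0 = la * pd i1 (X i1) 1 0).
  { assert (E := pd_ext i1 _ _ He1 1 0 Rlt_0_1). revert E.
    rewrite pd_euler_bracket by (auto; lra). rewrite pd_smooth_mul, pd_const
      by (auto with smooth; lra).
    unfold euler_deriv, fadd, fmul, fconst, coord_x, coord_y. lra. }
  assert (W112 : pd i1 (pd i1 (X i2)) 1 0 = la * pd i1 (X i2) 1 0).
  { assert (E := pd_ext i1 _ _ He2 1 0 Rlt_0_1). revert E.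
    rewrite pd_euler_bracket by (auto; lra).
    rewrite pd_smooth_add, pd_smooth_mul, !pd_const by (auto with smooth; lra).
    unfold euler_deriv, fadd, fmul, fconst, coord_x, coord_y. lra. }
  assert (Hlt : 0 < 1) by lra.
  assert (W121 : pd i1 (pd i2 (X i1)) 1 0 = be).
  { rewrite (pd_ext i1 _ _ Hy1 1 0 Hlt). pd_push. unfold fconst. ring. }
  assert (W122 : pd i1 (pd i2 (X i2)) 1 0 = 0).
  { rewrite (pd_ext i1 _ _ Hy2 1 0 Hlt). pd_push. unfold fconst. ring. }
  assert (W221 : pd i2 (pd i2 (X i1)) 1 0 = 0).
  { rewrite (pd_ext i2 _ _ Hy1 1 0 Hlt). pd_push. unfold fconst. ring. }
  assert (W222 : pd i2 (pd i2 (X i2)) 1 0 = be).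
  { rewrite (pd_ext i2 _ _ Hy2 1 0 Hlt). pd_push. unfold fconst. ring. }
  assert (K : forall i j k, _) by (intros i j k; exact (HK i j k 1 0 Hlt)).
  unfold sum2 in K.
  assert (K111 := K i1 i1 i1). assert (K112 := K i1 i1 i2).
  assert (K121 := K i1 i2 i1). assert (K122 := K i1 i2 i2).
  assert (K221 := K i2 i2 i1). assert (K222 := K i2 i2 i2).
  revert K111 K112 K121 K122 K221 K222. clear K.
  rewrite !(HC i2 i1), V21, V22, W111, W112, W121, W122, W221, W222, V11.
  intros K111 K112 K121 K122 K221 K222.
  split; lra.
Qed.

(** When [beta = 0] the components of [X] depend on [x] only and satisfy
    first-order linear equations, so their values at one point determine them up
    to a multiple of [d_y]. *)
Lemma graded_jet_nonzero (X : vector_field) (la ga : R) :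
  graded_field X 0 la ga ->
  (forall c d : R, ~ forall k x y, 0 < x ->
       X k x y = c * coord_field i2 k x y + d * euler_field k x y) ->
  X i1 1 0 <> 0 \/ pd i1 (X i2) 1 0 <> 0.
Proof.
  intros [HX Hy1 Hy2 He1 He2] Hind.
  destruct (Req_dec (X i1 1 0) 0) as [Hf|Hf]; [|now left].
  right. intros Hh.
  assert (Z1 : half_eq (pd i2 (X i1)) (fconst 0)).
  { intros x y Hx. rewrite (Hy1 x y Hx). unfold fmul, fconst. ring. }
  assert (Z2 : half_eq (pd i2 (X i2)) (fconst 0)).
  { intros x y Hx. rewrite (Hy2 x y Hx). unfold fmul, fconst. ring. }
  assert (F1 : half_eq (X i1) (fconst 0)).
  { apply (homogeneous_vanishes (X i1) (1 + la)); auto.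
    intros x y Hx. assert (E := He1 x y Hx).
    unfold euler_bracket, euler_deriv, fadd, fmul, fconst in E |- *.
    rewrite (Z1 x y Hx) in E. unfold fconst in E. lra. }
  assert (F2 : half_eq (pd i1 (X i2)) (fconst 0)).
  { apply (homogeneous_vanishes (pd i1 (X i2)) la); auto with smooth.
    - intros x y Hx. rewrite <- (pd_comm _ (HX i2) x y Hx).
      rewrite (pd_ext i1 _ _ Z2 x y Hx). apply pd_const.
    - intros x y Hx. assert (E := pd_ext i1 _ _ He2 x y Hx). revert E.
      rewrite pd_euler_bracket by auto.
      rewrite pd_smooth_add, pd_smooth_mul, !pd_const by auto with smooth.
      unfold euler_deriv, fadd, fmul, fconst.
      rewrite <- (pd_comm _ (HX i2) x y Hx), (pd_ext i1 _ _ Z2 x y Hx), pd_const.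
      lra. }
  assert (F3 : half_eq (X i2) (fconst (X i2 1 0))).
  { apply half_plane_constant; auto. intros [|]; assumption. }
  apply (Hind (X i2 1 0) 0). intros k x y Hx. destruct k.
  - rewrite (F1 x y Hx). unfold coord_field, fconst. ring.
  - rewrite (F3 x y Hx). unfold coord_field, fconst. ring.
Qed.

(** * Models with a larger Killing algebra *)

(** When the constants [C_12^1], [C_22^1], [C_22^2] vanish, fields along the lines
    of constant [x] only have to satisfy an ordinary differential equation. *)
Lemma affine_killing_fiber_field (C : idx -> idx -> idx -> R) (al : R)
    (g w w' : R -> R) :
  (forall i j k, C i j k = C j i k) ->
  C i1 i2 i1 = 0 -> C i2 i2 i1 = 0 -> C i2 i2 i2 = 0 ->
  (forall x, 0 < x -> is_derive g x (w x)) ->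
  (forall x, 0 < x -> is_derive w x (w' x)) ->
  smooth (fun_of_x w) ->
  (forall x, 0 < x ->
    x * w' x + (2 * C i1 i2 i2 - C i1 i1 i1) * w x = C i1 i1 i2 * al) ->
  affine_killing (typeB C) (fun k => match k with
    | i1 => fconst 0
    | i2 => fadd (fmul (fconst al) coord_y) (fun_of_x g) end).
Proof.
  intros HC Hu Hr Hv Dg Dw Sw Ho.
  assert (Sg : smooth (fun_of_x g)) by (apply smooth_fun_of_x with w; auto).
  apply affine_killing_typeB.
  set (Y := fun k : idx => match k with
    | i1 => fconst 0
    | i2 => fadd (fmul (fconst al) coord_y) (fun_of_x g) end).
  split; [intros [|]; simpl; auto with smooth|].
  assert (E1 : half_eq (pd i1 (Y i2)) (fun_of_x w)).
  { intros x y Hx. unfold Y. pd_push.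
    rewrite (pd1_fun_of_x g x y (w x)) by auto. unfold fun_of_x, fconst. ring. }
  assert (E2 : half_eq (pd i2 (Y i2)) (fconst al)).
  { intros x y Hx. unfold Y. pd_push.
    rewrite pd2_fun_of_x. unfold fconst. ring. }
  assert (E11 : forall x y, 0 < x -> pd i1 (pd i1 (Y i2)) x y = w' x).
  { intros x y Hx. rewrite (pd_ext i1 _ _ E1 x y Hx).
    now apply pd1_fun_of_x, Dw. }
  assert (E21 : forall x y, 0 < x -> pd i2 (pd i1 (Y i2)) x y = 0).
  { intros x y Hx. rewrite (pd_ext i2 _ _ E1 x y Hx).
    apply pd2_fun_of_x. }
  assert (EE2 : forall i x y, 0 < x -> pd i (pd i2 (Y i2)) x y = 0).
  { intros i x y Hx. rewrite (pd_ext i _ _ E2 x y Hx). apply pd_const. }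
  assert (Z : forall i x y, pd i (Y i1) x y = 0) by (intros; apply pd_const).
  assert (ZZ : forall i j x y, 0 < x -> pd i (pd j (Y i1)) x y = 0).
  { intros i j x y Hx.
    assert (Zj : half_eq (pd j (Y i1)) (fconst 0)) by (intros u v _; apply Z).
    rewrite (pd_ext i _ _ Zj x y Hx). apply pd_const. }
  intros i j k x y Hx. assert (O := Ho x Hx).
  unfold sum2. rewrite !Z.
  change (Y i1 x y) with 0.
  destruct i, j, k; rewrite ?ZZ, ?E11, ?E21, ?EE2, ?Z by auto;
    rewrite ?(E1 x y Hx), ?(E2 x y Hx); unfold fun_of_x, fconst;
    rewrite ?(HC i2 i1), ?Hu, ?Hr, ?Hv; try ring.
  transitivity (x * (x * w' x + (2 * C i1 i2 i2 - C i1 i1 i1) * w x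
    - C i1 i1 i2 * al)); [ring | rewrite O; ring].
Qed.

Lemma power_primitive (c : R) : exists g : R -> R,
  forall x, 0 < x -> is_derive g x (Rpower x c).
Proof.
  destruct (Req_dec c (- 1)) as [E|N].
  - exists ln. intros x Hx. rewrite E.
    replace (- 1) with (- (1)) by ring. rewrite Rpower_Ropp, Rpower_1 by auto.
    apply is_derive_Reals. now apply derivable_pt_lim_ln.
  - exists (fun x => / (c + 1) * Rpower x (c + 1)). intros x Hx.
    replace (Rpower x c) with (/ (c + 1) * ((c + 1) * Rpower x (c + 1 - 1))).
    + apply (is_derive_scal (fun t => Rpower t (c + 1)) x (/ (c + 1))).
      now apply is_derive_Rpower.
    + replace (c + 1 - 1) with c by ring. field. lra.
Qed.

(** The ordinary differential equation for [al = 0] and [al = 1] produces two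
    fields tangent to the lines of constant [x], independent of [d_y] and of [E]:
    too many for one additional field [X] to span them. *)
Lemma fiber_model_not_dim3 (C : idx -> idx -> idx -> R) (X : vector_field) :
  (forall i j k, C i j k = C j i k) ->
  C i1 i2 i1 = 0 -> C i2 i2 i1 = 0 -> C i2 i2 i2 = 0 ->
  (forall Y, affine_killing (typeB C) Y -> killing_span X Y) -> False.
Proof.
  intros HC Hu Hr Hv Hspan.
  set (p := C i1 i1 i1) in *. set (q := C i1 i2 i2) in *. set (s := C i1 i1 i2) in *.
  destruct (power_primitive (p - 2 * q)) as [g1 Dg1].
  assert (K1 := affine_killing_fiber_field C 0 g1 (fun x => Rpower x (p - 2 * q))
    (fun x => (p - 2 * q) * Rpower x (p - 2 * q - 1)) HC Hu Hr Hv Dg1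
    (fun x Hx => is_derive_Rpower (p - 2 * q) x Hx)
    (smooth_Rpower (p - 2 * q))).
  assert (exists g2 w w' : R -> R,
    (forall x, 0 < x -> is_derive g2 x (w x)) /\
    (forall x, 0 < x -> is_derive w x (w' x)) /\ smooth (fun_of_x w) /\
    forall x, 0 < x -> x * w' x + (2 * q - p) * w x = s * 1)
    as (g2 & w & w' & Dg2 & Dw & Sw & Ow).
  { destruct (Req_dec (2 * q - p) 0) as [E|N].
    - exists (fun x => s * (x * ln x - x)), (fun x => s * ln x), (fun x => s * / x).
      split; [|split; [|split]].
      + intros x Hx. auto_derive; [auto | field; lra].
      + intros x Hx. auto_derive; [auto | field; lra].
      + apply (smooth_mul (fconst s) (fun_of_x ln)); auto using smooth_ln with smooth.
      + intros x Hx. rewrite E. field. lra.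
    - exists (fun x => s / (2 * q - p) * x), (fun _ => s / (2 * q - p)), (fun _ => 0).
      split; [|split; [|split]].
      + intros x Hx. auto_derive; [auto | ring].
      + intros x Hx. auto_derive; [auto | ring].
      + exact (smooth_const (s / (2 * q - p))).
      + intros x Hx. field. auto. }
  assert (K2 := affine_killing_fiber_field C 1 g2 w w' HC Hu Hr Hv Dg2 Dw Sw Ow).
  assert (Ow1 : forall x, 0 < x ->
    x * ((p - 2 * q) * Rpower x (p - 2 * q - 1))
    + (2 * q - p) * Rpower x (p - 2 * q) = s * 0).
  { intros x Hx.
    replace (Rpower x (p - 2 * q)) with (x * Rpower x (p - 2 * q - 1)).
    - ring.
    - rewrite <- (Rpower_1 x) at 1 by auto. rewrite <- Rpower_plus.
      f_equal. ring. }
  destruct (Hspan _ (K1 Ow1)) as (c1 & d1 & m1 & E1).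
  destruct (Hspan _ K2) as (c2 & d2 & m2 & E2).
  (* Eliminate [X] between the two fields. *)
  assert (F1 : m2 * d1 - m1 * d2 = 0).
  { assert (A1 := E1 i1 1 0 Rlt_0_1). assert (A2 := E2 i1 1 0 Rlt_0_1).
    unfold coord_field, euler_field, coord_x, fconst in A1, A2.
    apply (f_equal (Rmult m2)) in A1. apply (f_equal (Rmult m1)) in A2. lra. }
  assert (F2 : forall x y, 0 < x ->
    m2 * g1 x - m1 * (y + g2 x) = m2 * c1 - m1 * c2).
  { intros x y Hx. assert (A1 := E1 i2 x y Hx). assert (A2 := E2 i2 x y Hx).
    unfold coord_field, euler_field, coord_y, fadd, fmul, fconst, fun_of_x in A1, A2.
    replace (1 * y + g2 x) with (y + g2 x) in A2 by ring.
    replace (0 * y + g1 x) with (g1 x) in A1 by ring. rewrite A1, A2.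
    replace (m2 * _ - m1 * _) with (m2 * c1 - m1 * c2 + (m2 * d1 - m1 * d2) * y)
      by ring. rewrite F1. ring. }
  assert (M1 : m1 = 0).
  { assert (A := F2 1 0 Rlt_0_1). assert (B := F2 1 1 Rlt_0_1). lra. }
  (* With no [X]-part, [g1] is constant although its derivative is positive. *)
  assert (D1 : d1 = 0).
  { assert (A1 := E1 i1 1 0 Rlt_0_1).
    unfold coord_field, euler_field, coord_x, fconst in A1. rewrite M1 in A1. lra. }
  assert (A : is_derive g1 1 0).
  { apply (is_derive_ext_loc (fun _ => c1)).
    - apply half_line_open; [lra|]. intros t Ht. assert (A1 := E1 i2 t 0 Ht).
      unfold coord_field, euler_field, coord_y, fadd, fmul, fconst, fun_of_x in A1.
      rewrite M1, D1 in A1. lra.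
    - exact (is_derive_const c1 1). }
  apply is_derive_unique in A. rewrite (is_derive_unique _ _ _ (Dg1 1 Rlt_0_1)) in A.
  assert (0 < Rpower 1 (p - 2 * q)) by apply exp_pos. lra.
Qed.

(** For [h = 0] the coordinates [x ^ 2 / 2 + r y ^ 2 / 2] and [y] are affine, so
    the connection is flat and [y x^-1 d_x] is a linear field; the general case
    is its image under a shear. *)
Lemma affine_killing_flat_field (C : idx -> idx -> idx -> R) (h r : R) :
  (forall i j k, C i j k = C j i k) ->
  C i1 i1 i1 = 1 + r * h ^ 2 -> C i1 i1 i2 = - h - r * h ^ 3 ->
  C i1 i2 i1 = r * h -> C i1 i2 i2 = - r * h ^ 2 ->
  C i2 i2 i1 = r -> C i2 i2 i2 = - r * h ->
  affine_killing (typeB C) (fun k => match k with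
    | i1 => fadd (fmul coord_y (fun_of_x Rinv)) (fconst h)
    | i2 => fadd (fmul (fconst (- h)) (fmul coord_y (fun_of_x Rinv)))
                 (fconst (- h ^ 2)) end).
Proof.
  intros HC Hp Hs Hu Hq Hr Hv. apply affine_killing_typeB.
  set (xi := fun_of_x Rinv). assert (Si : smooth xi) by exact smooth_inv.
  set (Y := fun k : idx => match k with
    | i1 => fadd (fmul coord_y xi) (fconst h)
    | i2 => fadd (fmul (fconst (- h)) (fmul coord_y xi)) (fconst (- h ^ 2)) end).
  split; [intros [|]; simpl; auto with smooth|].
  assert (I1 : forall x y, 0 < x ->
    pd i1 xi x y = - (xi x y * xi x y)) by exact pd1_inv.
  assert (I2 : forall x y, pd i2 xi x y = 0) by exact (pd2_fun_of_x Rinv).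
  set (t := fun k : idx => match k with i1 => 1 | i2 => - h end).
  assert (E1 : forall k, half_eq (pd i1 (Y k))
    (fmul (fconst (- t k)) (fmul coord_y (fmul xi xi)))).
  { intros k x y Hx. destruct k; unfold Y; pd_push; rewrite (I1 x y Hx);
      unfold fmul, fconst, t; ring. }
  assert (E2 : forall k, half_eq (pd i2 (Y k)) (fmul (fconst (t k)) xi)).
  { intros k x y Hx. destruct k; unfold Y; pd_push; rewrite I2;
      unfold fmul, fconst, t; ring. }
  assert (E11 : forall k x y, 0 < x ->
    pd i1 (pd i1 (Y k)) x y = 2 * t k * y * (/ x) ^ 3).
  { intros k x y Hx. rewrite (pd_ext i1 _ _ (E1 k) x y Hx). pd_push.
    rewrite (I1 x y Hx). unfold fmul, fconst, xi, fun_of_x, coord_y. ring. }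
  assert (E12 : forall k x y, 0 < x ->
    pd i1 (pd i2 (Y k)) x y = - t k * (/ x) ^ 2).
  { intros k x y Hx. rewrite (pd_ext i1 _ _ (E2 k) x y Hx). pd_push.
    rewrite (I1 x y Hx). unfold fmul, fconst, xi, fun_of_x, coord_y. ring. }
  assert (E21 : forall k x y, 0 < x ->
    pd i2 (pd i1 (Y k)) x y = - t k * (/ x) ^ 2).
  { intros k x y Hx. rewrite (pd_ext i2 _ _ (E1 k) x y Hx). pd_push.
    rewrite I2. unfold fmul, fconst, xi, fun_of_x, coord_y. ring. }
  assert (E22 : forall k x y, 0 < x -> pd i2 (pd i2 (Y k)) x y = 0).
  { intros k x y Hx. rewrite (pd_ext i2 _ _ (E2 k) x y Hx). pd_push.
    rewrite I2. unfold fmul, fconst. ring. }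
  intros i j k x y Hx. unfold sum2.
  destruct i, j; rewrite ?E11, ?E12, ?E21, ?E22 by auto;
    rewrite ?(E1 _ x y Hx), ?(E2 _ x y Hx); unfold fmul, fconst, xi, fun_of_x,
    coord_y; destruct k; rewrite ?(HC i2 i1), ?Hu, ?Hr, ?Hv, ?Hp, ?Hs, ?Hq;
    unfold Y, t, fadd, fmul, fconst, coord_y, xi, fun_of_x; field; lra.
Qed.

(** * Classification *)

(** Here [c = X^1 / beta] at (1, 0) is the slope of the shear that kills the
    [x ^ 2] term of [X^1]; [U] and [G] are the values of [C_12^1] and of
    [d_x X^2 / beta] after this shear.  The relation [G (1 + r G) = 0]
    separates the models sheared from [C_11^1 = -3/2], where [G = 0], from those
    sheared from [N3] and [N4]. *)
Lemma killing_dim3_parameters (C : idx -> idx -> idx -> R) :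
  (forall i j k, C i j k = C j i k) -> killing_dim (typeB C) 3 ->
  exists c U r G : R,
    U * G = 0 /\ G * (1 + r * G) = 0 /\ (U <> 0 \/ r <> 0) /\
    C i1 i1 i1 = - (3 / 2) + 2 * c * U + c ^ 2 * r - r * G / 2 /\
    C i1 i1 i2 = c / 2 - c ^ 3 * r + 3 / 2 * c * r * G /\
    C i1 i2 i1 = U + c * r /\
    C i1 i2 i2 = - (1 / 2) + c * U - c ^ 2 * r + r * G / 2 /\
    C i2 i2 i1 = r /\
    C i2 i2 i2 = 2 * U - c * r.
Proof.
  intros HC Hdim.
  destruct (killing_graded_frame C Hdim)
    as (X & be & la & ga & KX & GX & Hla & Hind & Hspan).
  destruct (graded_jet_equations C X be la ga HC KX GX) as [E1 E2 E3 E4 E5 E6].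
  destruct (Req_dec be 0) as [Hbe|Hbe].
  - exfalso. rewrite Hbe in *.
    assert (Hn := graded_jet_nonzero X la ga GX Hind).
    set (f := X i1 1 0) in *. set (h := pd i1 (X i2) 1 0) in *.
    set (a := 1 + la) in *.
    destruct (Req_dec f 0) as [Hf|Hf].
    { rewrite Hf in *. destruct Hn as [Hn|Hh]; [lra|].
      assert (Hu : C i1 i2 i1 = 0) by (apply Rmult_eq_reg_r with h; auto; lra).
      apply (fiber_model_not_dim3 C X HC); auto.
      - apply Rmult_eq_reg_r with h; auto. lra.
      - rewrite Hu in *. apply Rmult_eq_reg_r with h; auto. lra. }
    assert (R0 : C i2 i2 i1 * (1 + a) = 0).
    { apply Rmult_eq_reg_r with f; auto. lra. }
    destruct (Req_dec (C i2 i2 i1) 0) as [Hr|Hr].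
    { rewrite Hr in *.
      apply (fiber_model_not_dim3 C X HC); auto;
        apply Rmult_eq_reg_r with f; auto; lra. }
    assert (Ha : a = - 1).
    { apply Rmult_integral in R0. destruct R0; [contradiction|lra]. }
    rewrite Ha in *. set (r := C i2 i2 i1) in *. set (h0 := h / f).
    assert (Hh : h = h0 * f) by (unfold h0; field; auto). rewrite Hh in *.
    assert (Hu : C i1 i2 i1 = r * h0) by (apply Rmult_eq_reg_r with f; auto; lra).
    assert (Hv : C i2 i2 i2 = - r * h0) by (apply Rmult_eq_reg_r with f; auto; lra).
    rewrite Hu, Hv in *.
    assert (Hq : C i1 i2 i2 = - r * h0 ^ 2)
      by (apply Rmult_eq_reg_r with f; auto; lra).
    assert (Hp : C i1 i1 i1 = 1 + r * h0 ^ 2)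
      by (apply Rmult_eq_reg_r with f; auto; lra).
    rewrite Hp, Hq in *.
    assert (Hs : C i1 i1 i2 = - h0 - r * h0 ^ 3)
      by (apply Rmult_eq_reg_r with f; auto; lra).
    destruct (Hspan _ (affine_killing_flat_field C h0 r HC Hp Hs Hu Hq eq_refl Hv))
      as (c & d & m & Y).
    (* The first components of the spanning fields do not depend on [y]. *)
    assert (Y1 : half_eq (fadd (fmul coord_y (fun_of_x Rinv)) (fconst h0))
      (fadd (fmul (fconst d) coord_x) (fmul (fconst m) (X i1)))).
    { intros x y Hx. rewrite (Y i1 x y Hx).
      unfold coord_field, euler_field, fadd, fmul, fconst. ring. }
    destruct GX as [SX Gy1 _ _ _]. assert (Hlt : 0 < 1) by lra.
    assert (D := pd_ext i2 _ _ Y1 1 0 Hlt). revert D. pd_push.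
    rewrite pd2_fun_of_x, (Gy1 1 0 Hlt). unfold fmul, fconst, fun_of_x. rewrite Rinv_1. lra.
  - rewrite (Hla Hbe) in *.
    set (f := X i1 1 0) in *. set (h := pd i1 (X i2) 1 0) in *.
    set (c := f / be). set (k := h / be).
    assert (Hf : f = c * be) by (unfold c; field; auto).
    assert (Hk : h = k * be) by (unfold k; field; auto).
    rewrite Hf, Hk in *.
    set (r := C i2 i2 i1) in *. set (u := C i1 i2 i1) in *.
    set (U := u - c * r). set (G := k + c ^ 2).
    assert (Hu : u = U + c * r) by (unfold U; ring).
    assert (Hk' : k = G - c ^ 2) by (unfold G; ring).
    assert (Hv : C i2 i2 i2 = 2 * U - c * r).
    { apply Rmult_eq_reg_r with be; auto. rewrite Hu in *. lra. }
    rewrite Hv, Hu, Hk' in *. clearbody U G.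
    assert (Hq : C i1 i2 i2 = - (1 / 2) + c * U - c ^ 2 * r + r * G / 2).
    { apply Rmult_eq_reg_r with be; auto. lra. }
    rewrite Hq in *.
    assert (Hp : C i1 i1 i1 = - (3 / 2) + 2 * c * U + c ^ 2 * r - r * G / 2).
    { apply Rmult_eq_reg_r with be; auto. lra. }
    rewrite Hp in *.
    assert (Hs : C i1 i1 i2 = c / 2 - c ^ 3 * r + 3 / 2 * c * r * G + 2 * (U * G)).
    { apply Rmult_eq_reg_r with be; auto. lra. }
    rewrite Hs in *.
    assert (HUG : U * G = 0) by (apply Rmult_eq_reg_r with be; auto; lra).
    assert (HG : G * (1 + r * G) = 0).
    { apply (f_equal (fun t => c * be * t)) in HUG.
      apply Rmult_eq_reg_r with be; auto. lra. }
    exists c, U, r, G. repeat split; auto; try lra.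
    destruct (Req_dec U 0) as [HU|HU]; auto.
    destruct (Req_dec r 0) as [Hr|Hr]; auto.
    exfalso. apply (fiber_model_not_dim3 C X HC); auto.
    + fold u. rewrite Hu, HU, Hr. ring.
    + rewrite Hv, HU, Hr. ring.
Qed.

(** The case [G = 0] of [killing_dim3_parameters]: for [u = 0] and [r] equal to
    -1/2 or 1/2 these are the models [N1_plus] and [N1_minus], for [u = 1] the
    models often called N_2^c. *)
Definition slant_model (u r : R) (i j k : idx) : R :=
  match i, j, k with
  | i1, i1, i1 => - (3 / 2)
  | i1, i2, i1 | i2, i1, i1 => u
  | i1, i2, i2 | i2, i1, i2 => - (1 / 2)
  | i2, i2, i1 => r
  | i2, i2, i2 => 2 * u
  | _, _, _ => 0
  end.

Lemma slant_model_N1_plus : slant_model 0 (- (1 / 2)) = N1_plus.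
Proof.
  extensionality i; extensionality j; extensionality k.
  destruct i, j, k; unfold slant_model, N1_plus, diag_model; ring.
Qed.

Lemma slant_model_N1_minus : slant_model 0 (1 / 2) = N1_minus.
Proof.
  extensionality i; extensionality j; extensionality k.
  destruct i, j, k; unfold slant_model, N1_minus, diag_model; ring.
Qed.

Inductive normal_form : (idx -> idx -> idx -> R) -> Prop :=
| normal_N3 : normal_form N3
| normal_N4 : normal_form N4
| normal_N1_plus : normal_form N1_plus
| normal_N1_minus : normal_form N1_minus
| normal_slant r : normal_form (slant_model 1 r).

Lemma square_times_sign (r k : R) : r <> 0 -> 0 < k ->
  exists b, b <> 0 /\ (r = b ^ 2 * k \/ r = b ^ 2 * - k).
Proof.
  intros Hr Hk. exists (sqrt (Rabs r / k)).
  assert (P : 0 < Rabs r / k) by (apply Rdiv_lt_0_compat; auto using Rabs_pos_lt).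
  assert (S : sqrt (Rabs r / k) ^ 2 = Rabs r / k)
    by (simpl; rewrite Rmult_1_r; apply sqrt_sqrt; lra).
  split.
  - intros H. apply sqrt_lt_R0 in P. lra.
  - rewrite S. destruct (Rle_dec 0 r) as [H|H]; [left|right].
    + rewrite Rabs_pos_eq by auto. field. lra.
    + rewrite Rabs_left by lra. field. lra.
Qed.

(** After the shear of slope [c], the remaining freedom is the rescaling of [y]
    by [b], which divides [U] by [b] and [r] by [b ^ 2]. *)
Lemma killing_dim3_normal_form (C : idx -> idx -> idx -> R) :
  (forall i j k, C i j k = C j i k) -> killing_dim (typeB C) 3 ->
  exists D a b, normal_form D /\ b <> 0 /\ shear_related a b C D.
Proof.
  intros HC Hdim.
  destruct (killing_dim3_parameters C HC Hdim)
    as (c & U & r & G & HUG & HG & Hne & Hp & Hs & Hu & Hq & Hr & Hv).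
  assert (Red : forall b D, b <> 0 ->
    (forall i j k, D i j k = D j i k) ->
    D i1 i1 i1 = - (3 / 2) - r * G / 2 -> D i1 i1 i2 = 0 ->
    U = b * D i1 i2 i1 -> D i1 i2 i2 = - (1 / 2) + r * G / 2 ->
    r = b ^ 2 * D i2 i2 i1 -> D i2 i2 i2 = 2 * D i1 i2 i1 ->
    r * G = 0 \/ r * G = -1 -> shear_related (c * b) b C D).
  { intros b D Hb HD D1 D2 D3 D4 D5 D6 HrG i j.
    destruct i, j; rewrite ?(HC i2 i1), ?Hp, ?Hs, ?Hu, ?Hq, ?Hr, ?Hv;
      unfold shear_pull, shear_jac, sum2; rewrite ?(HD i2 i1), ?D1, ?D2, ?D4, ?D6;
      (replace (3 / 2 * c * r * G) with (3 / 2 * c * (r * G)) by ring);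
      destruct HrG as [Z|Z]; rewrite ?Z, ?D3, ?D5; split; field; auto. }
  assert (Sd : forall p q k i j l, diag_model p q k i j l = diag_model p q k j i l)
    by (intros p q k i j l; destruct i, j, l; reflexivity).
  destruct (Req_dec G 0) as [HG0|HG0].
  - rewrite HG0 in *. destruct (Req_dec U 0) as [HU|HU].
    + destruct Hne as [Hne|Hne]; [contradiction|].
      destruct (square_times_sign r (1 / 2) Hne) as (b & Hb & [E|E]); [lra| |].
      * exists N1_minus, (c * b), b. split; [constructor|]. split; auto.
        apply Red; [exact Hb | exact (Sd _ _ _) | ..];
          unfold N1_minus, diag_model; lra.
      * exists N1_plus, (c * b), b. split; [constructor|]. split; auto.
        apply Red; [exact Hb | exact (Sd _ _ _) | ..];
          unfold N1_plus, diag_model; lra.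
    + exists (slant_model 1 (r / U ^ 2)), (c * U), U.
      split; [constructor|]. split; auto.
      apply Red; auto; try (unfold slant_model; lra).
      * intros i j k. destruct i, j, k; reflexivity.
      * unfold slant_model. field. auto.
  - assert (HU : U = 0) by (apply Rmult_integral in HUG; tauto).
    assert (HrG : r * G = -1).
    { apply Rmult_integral in HG. destruct HG; [contradiction|lra]. }
    assert (Hr0 : r <> 0) by (intros E; rewrite E in HrG; lra).
    destruct (square_times_sign r 1 Hr0) as (b & Hb & [E|E]); [lra| |].
    + exists N4, (c * b), b. split; [constructor|]. split; auto.
      apply Red; [exact Hb | exact (Sd _ _ _) | ..];
        unfold N4, diag_model; lra.
    + exists N3, (c * b), b. split; [constructor|]. split; auto.
      apply Red; [exact Hb | exact (Sd _ _ _) | ..];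
        unfold N3, diag_model; lra.
Qed.

(** * Quasi-Einstein functions of the normal forms *)

Lemma quasi_einstein_ext (mu : R) (C : idx -> idx -> idx -> R)
    (f g : scalar_field) :
  half_eq f g -> quasi_einstein mu C f -> quasi_einstein mu C g.
Proof.
  intros E H i j x y Hx. unfold sum2.
  assert (E' := half_eq_sym _ _ E).
  rewrite (pd_ext i _ _ (pd_ext j _ _ E') x y Hx), !(pd_ext _ _ _ E' x y Hx),
    (E' x y Hx).
  now apply H.
Qed.

Lemma qe_space_ext (mu : R) (C : idx -> idx -> idx -> R) (f g : scalar_field) :
  half_eq f g -> qe_space mu (typeB C) f -> qe_space mu (typeB C) g.
Proof.
  rewrite !qe_space_typeB. intros E [Hf H]. split.
  - now apply smooth_ext with f.
  - now apply quasi_einstein_ext with f.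
Qed.

Lemma shear_related_inverse (a b : R) (C D : idx -> idx -> idx -> R) :
  b <> 0 -> shear_related a b C D -> shear_related (- a / b) (/ b) D C.
Proof.
  intros Hb H. 
  assert (A1 : forall i j, shear_pull (- a / b) (/ b) C i j i1 = D i j i1).
  { intros i j. unfold shear_pull, sum2. rewrite !(proj1 (H _ _)).
    unfold shear_pull, sum2. destruct i, j; unfold shear_jac; field; auto. }
  assert (A2 : forall i j, shear_pull (- a / b) (/ b) C i j i2
    = (D i j i2 - a * D i j i1) / b).
  { intros i j. unfold shear_pull, sum2.
    rewrite !(proj2 (H _ _)), !(proj1 (H _ _)).
    unfold shear_pull, sum2. destruct i, j; unfold shear_jac; field; auto. }
  intros i j. rewrite A1, A2. split; [reflexivity|]. field. auto.
Qed.

Lemma qe_space_shear (mu a b : R) (C D : idx -> idx -> idx -> R)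
    (f : scalar_field) : b <> 0 -> shear_related a b C D ->
  qe_space mu (typeB C) f <-> pullback a b (qe_space mu (typeB D)) f.
Proof.
  intros Hb H. split.
  - intros Hf. apply qe_space_typeB in Hf. destruct Hf as [Sf Qf].
    exists (fshear (- a / b) (/ b) f). split.
    + apply qe_space_typeB. split; [now apply smooth_shear|].
      apply quasi_einstein_shear with C; auto.
      * now apply Rinv_neq_0_compat.
      * now apply shear_related_inverse.
    + intros x y _. unfold fshear. f_equal. field. auto.
  - intros (g & Hg & E). apply qe_space_ext with (fshear a b g).
    + intros x y Hx. symmetry. now apply E.
    + apply qe_space_typeB in Hg. destruct Hg as [Sg Qg].
      apply qe_space_typeB. split; [now apply smooth_shear|].
      now apply quasi_einstein_shear with D.
Qed.

(** The first prolongation of the equation. *)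
Lemma quasi_einstein_pd (mu : R) (C : idx -> idx -> idx -> R) (f : scalar_field)
    (l i j : idx) (x y : R) :
  smooth f -> quasi_einstein mu C f -> 0 < x ->
  pd l coord_x x y * (2 * x * pd i (pd j f) x y)
  + x ^ 2 * pd l (pd i (pd j f)) x y
  = pd l coord_x x y * sum2 (fun k => C i j k * pd k f x y)
    + x * sum2 (fun k => C i j k * pd l (pd k f) x y)
    + mu * ricci_sym_const C i j * pd l f x y.
Proof.
  intros Hf H Hx.
  assert (E : half_eq (fmul (fmul coord_x coord_x) (pd i (pd j f)))
    (fadd (fmul coord_x (fadd (fmul (fconst (C i j i1)) (pd i1 f))
                              (fmul (fconst (C i j i2)) (pd i2 f))))
          (fmul (fconst (mu * ricci_sym_const C i j)) f))).
  { intros u v Hu. unfold fadd, fmul, fconst, coord_x.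
    replace (u * u) with (u ^ 2) by ring. now apply H. }
  assert (E' := pd_ext l _ _ E x y Hx). revert E'.
  repeat first
    [ rewrite pd_smooth_add by auto 20 with smooth
    | rewrite pd_smooth_mul by auto 20 with smooth ].
  rewrite !pd_const. unfold fadd, fmul, fconst, sum2.
  change (coord_x x y) with x. lra.
Qed.

Lemma constant_of_gradient (f : scalar_field) : smooth f ->
  half_eq (pd i1 f) (fconst 0) -> half_eq (pd i2 f) (fconst 0) ->
  exists c, half_eq f (fconst c).
Proof.
  intros Hf H1 H2. exists (f 1 0). apply half_plane_constant; auto.
  intros [|]; assumption.
Qed.

Lemma affine_in_y (f : scalar_field) : smooth f ->
  half_eq (pd i1 f) (fconst 0) -> half_eq (pd i2 (pd i2 f)) (fconst 0) ->
  exists c0 c1, forall x y, 0 < x -> f x y = c0 + c1 * y.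
Proof.
  intros Hf H1 H22.
  destruct (constant_of_gradient (pd i2 f)) as [c1 Hc1]; auto with smooth.
  { intros x y Hx. rewrite (pd_comm f Hf x y Hx), (pd_ext i2 _ _ H1 x y Hx).
    apply pd_const. }
  destruct (constant_of_gradient
    (fadd f (fmul (fconst (- c1)) coord_y))) as [c0 Hc0]; auto with smooth.
  - intros x y Hx. pd_push. rewrite (H1 x y Hx). unfold fconst. ring.
  - intros x y Hx. pd_push. rewrite (Hc1 x y Hx). unfold fconst. ring.
  - exists c0, c1. intros x y Hx. assert (E := Hc0 x y Hx).
    unfold fadd, fmul, fconst, coord_y in E. lra.
Qed.

(** At [u ^ 2 = 2 r] the Ricci tensor is skew-symmetric. *)
Lemma ricci_sym_const_slant (u r : R) (i j : idx) :
  ricci_sym_const (slant_model u r) i j =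
  match i, j with i2, i2 => u ^ 2 - 2 * r | _, _ => 0 end.
Proof.
  unfold ricci_sym_const, ricci_const, sum2, slant_model.
  destruct i, j; field.
Qed.

Lemma ricci_sym_const_metric (e : R) (i j : idx) :
  ricci_sym_const (diag_model (-1) (-1) e) i j =
  match i, j with i1, i1 => -1 | i2, i2 => - e | _, _ => 0 end.
Proof.
  unfold ricci_sym_const, ricci_const, sum2, diag_model.
  destruct i, j; field.
Qed.

(** The first relation comes from the two expressions for [d_x d_x d_y f], the
    second from those for [d_x d_y d_y f]. *)
Lemma slant_integrability (mu u r : R) (f : scalar_field) (x y : R) :
  smooth f -> quasi_einstein mu (slant_model u r) f -> 0 < x ->
  u * pd i1 f x y = 0 /\
  (u = 0 -> 2 * r * ((mu + 1) * (2 * (x * pd i1 f x y)) - 3 * mu * f x y) = 0).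
Proof.
  intros Hf H Hx.
  assert (E11 := H i1 i1 x y Hx). assert (E12 := H i1 i2 x y Hx).
  assert (E22 := H i2 i2 x y Hx).
  assert (P211 := quasi_einstein_pd mu _ f i2 i1 i1 x y Hf H Hx).
  assert (P112 := quasi_einstein_pd mu _ f i1 i1 i2 x y Hf H Hx).
  assert (P212 := quasi_einstein_pd mu _ f i2 i1 i2 x y Hf H Hx).
  assert (P122 := quasi_einstein_pd mu _ f i1 i2 i2 x y Hf H Hx).
  rewrite !ricci_sym_const_slant in *. unfold sum2, slant_model in *.
  rewrite !pd1_coord_x in *. rewrite !pd2_coord_x in *.
  rewrite (pd_swap3 i2 i1 i1 f Hf x y Hx) in P211.
  rewrite (pd_swap i2 i1) in P212 by auto with smooth.
  rewrite <- (pd_swap i1 i2 f Hf x y Hx) in *.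
  set (f1 := pd i1 f x y) in *. set (f2 := pd i2 f x y) in *.
  set (f11 := pd i1 (pd i1 f) x y) in *. set (f12 := pd i1 (pd i2 f) x y) in *.
  set (f22 := pd i2 (pd i2 f) x y) in *.
  assert (S11 : x * f11 = - (3 / 2) * f1) by (apply Rmult_eq_reg_l with x; lra).
  assert (S12 : x * f12 = u * f1 - f2 / 2) by (apply Rmult_eq_reg_l with x; lra).
  split.
  - apply (f_equal (Rmult u)) in S11. lra.
  - intros Hu. rewrite Hu in *.
    apply (f_equal (Rmult x)) in P212. apply (f_equal (Rmult x)) in P122.
    apply (f_equal (Rmult (r * x))) in S11. lra.
Qed.

Lemma slant_constant (mu u r : R) (f : scalar_field) :
  smooth f -> quasi_einstein mu (slant_model u r) f ->
  half_eq (pd i1 f) (fconst 0) -> exists c, half_eq f (fconst c).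
Proof.
  intros Hf H H1. apply constant_of_gradient; auto.
  intros x y Hx. assert (E := H i1 i2 x y Hx).
  rewrite (pd_comm f Hf x y Hx), (pd_ext i2 _ _ H1 x y Hx), pd_const in E.
  unfold sum2 in E. rewrite ricci_sym_const_slant, (H1 x y Hx) in E.
  unfold slant_model, fconst in E. unfold fconst.
  apply Rmult_eq_reg_l with x; lra.
Qed.

Lemma slant_skew_constant (mu r : R) (f : scalar_field) :
  smooth f -> quasi_einstein mu (slant_model 1 r) f ->
  exists c, half_eq f (fconst c).
Proof.
  intros Hf H. apply (slant_constant mu 1 r); auto. intros x y Hx.
  destruct (slant_integrability mu 1 r f x y Hf H Hx) as [E _].
  unfold fconst. lra.
Qed.

Lemma slant_upright_first_order (mu r : R) (f : scalar_field) :
  r <> 0 -> smooth f -> quasi_einstein mu (slant_model 0 r) f ->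
  half_eq (fmul (fconst (2 * (mu + 1))) (fmul coord_x (pd i1 f)))
          (fmul (fconst (3 * mu)) f).
Proof.
  intros Hr Hf H x y Hx.
  destruct (slant_integrability mu 0 r f x y Hf H Hx) as [_ E].
  specialize (E eq_refl). apply Rmult_integral in E.
  unfold fmul, fconst, coord_x. destruct E; lra.
Qed.

(** Differentiating the first-order relation and comparing with
    [x f_xx = - (3 / 2) f_x] gives [(4 mu + 1) f_x = 0]. *)
Lemma slant_upright_constant (mu r : R) (f : scalar_field) :
  r <> 0 -> mu <> - (1 / 4) -> smooth f ->
  quasi_einstein mu (slant_model 0 r) f -> exists c, half_eq f (fconst c).
Proof.
  intros Hr Hmu Hf H. apply (slant_constant mu 0 r); auto. intros x y Hx.
  assert (E := pd_ext i1 _ _ (slant_upright_first_order mu r f Hr Hf H) x y Hx).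
  revert E. pd_push. unfold fmul, fconst. intros E.
  assert (E11 := H i1 i1 x y Hx). rewrite ricci_sym_const_slant in E11.
  unfold sum2, slant_model in E11.
  assert (S11 : x * pd i1 (pd i1 f) x y = - (3 / 2) * pd i1 f x y)
    by (apply Rmult_eq_reg_l with x; lra).
  change (coord_x x y) with x in E. rewrite S11 in E.
  apply Rmult_eq_reg_l with (4 * mu + 1); lra.
Qed.

(** Here [2 x f_x = - f], so [x ^ (1 / 2) f] does not depend on [x]; the equation
    for [f_yy] makes it affine in [y]. *)
Lemma slant_upright_special (r : R) (f : scalar_field) :
  r <> 0 -> smooth f -> quasi_einstein (- (1 / 4)) (slant_model 0 r) f ->
  N1_space f.
Proof.
  intros Hr Hf H.
  set (P := fun_of_x (fun x => Rpower x (1 / 2))).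
  assert (HP : smooth P) by apply smooth_Rpower.
  assert (D1 : forall x y, 0 < x -> pd i1 P x y = 1 / 2 * Rpower x (1 / 2 - 1)).
  { intros x y Hx. now apply is_derive_unique, is_derive_Rpower. }
  assert (D2 : forall x y, pd i2 P x y = 0) by apply pd2_fun_of_x.
  assert (X1 : forall x y, 0 < x -> 2 * (x * pd i1 f x y) = - f x y).
  { intros x y Hx.
    assert (E := slant_upright_first_order _ r f Hr Hf H x y Hx).
    unfold fmul, fconst, coord_x in E. lra. }
  destruct (affine_in_y (fmul P f)) as (c0 & c1 & E).
  - auto with smooth.
  - intros x y Hx. pd_push. rewrite D1 by auto. unfold P, fun_of_x, fconst.
    replace (Rpower x (1 / 2)) with (x * Rpower x (1 / 2 - 1)).
    + replace (_ + _) with (Rpower x (1 / 2 - 1) / 2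
        * (f x y + 2 * (x * pd i1 f x y))) by field.
      rewrite X1 by auto. ring.
    + rewrite <- (Rpower_1 x) at 1 by auto. rewrite <- Rpower_plus. f_equal. ring.
  - assert (E2 : half_eq (pd i2 (fmul P f)) (fmul P (pd i2 f))).
    { intros x y Hx. pd_push. rewrite D2. unfold fmul, fconst. ring. }
    intros x y Hx. rewrite (pd_ext i2 _ _ E2 x y Hx). pd_push.
    rewrite D2. unfold fconst.
    assert (E22 := H i2 i2 x y Hx). rewrite ricci_sym_const_slant in E22.
    unfold sum2, slant_model in E22. assert (A := X1 x y Hx).
    assert (Z : pd i2 (pd i2 f) x y = 0).
    { apply Rmult_eq_reg_l with (x ^ 2); [|apply pow_nonzero; lra].
      apply (f_equal (Rmult r)) in A. lra. }
    rewrite Z. ring.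
  - exists (fun l => match l with 0%nat => c0 | _ => c1 end). intros x y Hx.
    assert (Q := E x y Hx). unfold rsum. simpl.
    unfold fmul, P, fun_of_x in Q. rewrite Rpower_Ropp.
    assert (0 < Rpower x (1 / 2)) by apply exp_pos.
    apply Rmult_eq_reg_l with (Rpower x (1 / 2)); [|lra].
    rewrite Q. field. lra.
Qed.

Lemma Span_two (g h0 h1 f : scalar_field) : Span g (h0 :: h1 :: nil) f ->
  exists c0 c1, half_eq f
    (fadd (fmul (fconst c0) (fmul g h0)) (fmul (fconst c1) (fmul g h1))).
Proof.
  intros [c Hc]. exists (c 0%nat), (c 1%nat). intros x y Hx.
  rewrite (Hc x y Hx). unfold rsum. simpl. unfold fadd, fmul, fconst. ring.
Qed.

Lemma Span_three (g h0 h1 h2 f : scalar_field) :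
  Span g (h0 :: h1 :: h2 :: nil) f ->
  exists c0 c1 c2, half_eq f
    (fadd (fadd (fmul (fconst c0) (fmul g h0)) (fmul (fconst c1) (fmul g h1)))
          (fmul (fconst c2) (fmul g h2))).
Proof.
  intros [c Hc]. exists (c 0%nat), (c 1%nat), (c 2%nat). intros x y Hx.
  rewrite (Hc x y Hx). unfold rsum. simpl. unfold fadd, fmul, fconst. ring.
Qed.

Lemma N1_space_quasi_einstein (r : R) (f : scalar_field) : N1_space f ->
  smooth f /\ quasi_einstein (- (1 / 4)) (slant_model 0 r) f.
Proof.
  intros Hf. apply Span_two in Hf. destruct Hf as (c0 & c1 & Hf).
  set (P := fun_of_x (fun x => Rpower x (- (1 / 2)))).
  assert (HP : smooth P) by apply smooth_Rpower.
  set (g := fadd (fmul (fconst c0) P) (fmul (fconst c1) (fmul P coord_y))).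
  assert (E : half_eq f g).
  { intros x y Hx. rewrite (Hf x y Hx).
    unfold g, P, fadd, fmul, fconst, fun_of_x, coord_y. ring. }
  apply half_eq_sym in E.
  assert (Sg : smooth g) by (unfold g; auto with smooth).
  split; [now apply smooth_ext with g|]. apply quasi_einstein_ext with g; auto.
  set (xi := fun_of_x Rinv). assert (Si : smooth xi) by exact smooth_inv.
  assert (I1 : forall x y, 0 < x ->
    pd i1 xi x y = - (xi x y * xi x y)) by exact pd1_inv.
  assert (D1 : half_eq (pd i1 P) (fmul (fconst (- (1 / 2))) (fmul xi P))).
  { intros x y Hx. transitivity (- (1 / 2) * Rpower x (- (1 / 2) - 1)).
    - now apply is_derive_unique, is_derive_Rpower.
    - unfold fmul, fconst, xi, P, fun_of_x. f_equal.
      replace (- (1 / 2) - 1) with (- (1) + - (1 / 2)) by ring.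
      rewrite Rpower_plus, Rpower_Ropp, Rpower_1; auto. }
  assert (D2 : forall x y, pd i2 P x y = 0) by apply pd2_fun_of_x.
  assert (G1 : half_eq (pd i1 g) (fmul (fconst (- (1 / 2))) (fmul xi g))).
  { intros x y Hx. unfold g. pd_push. rewrite (D1 x y Hx).
    unfold fadd, fmul, fconst. ring. }
  assert (G2 : half_eq (pd i2 g) (fmul (fconst c1) P)).
  { intros x y Hx. unfold g. pd_push. rewrite D2.
    unfold fadd, fmul, fconst. ring. }
  intros i j x y Hx. rewrite ricci_sym_const_slant. unfold sum2.
  assert (A : forall i, pd i (pd i1 g) x y = match i with
    | i1 => 3 / 4 * (/ x) ^ 2 * g x y | i2 => - (1 / 2) * (/ x * (c1 * P x y)) end).
  { intros l. rewrite (pd_ext l _ _ G1 x y Hx). destruct l; pd_push.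
    - rewrite (I1 x y Hx), (G1 x y Hx). unfold fmul, fconst, xi, fun_of_x. field. lra.
    - unfold xi. rewrite pd2_fun_of_x.
      rewrite (G2 x y Hx). unfold fmul, fconst, xi, fun_of_x. ring. }
  assert (B : forall i, pd i (pd i2 g) x y = match i with
    | i1 => - (1 / 2) * (/ x * (c1 * P x y)) | i2 => 0 end).
  { intros l. rewrite (pd_ext l _ _ G2 x y Hx). destruct l; pd_push.
    - rewrite (D1 x y Hx). unfold fmul, fconst, xi, fun_of_x. ring.
    - rewrite D2. unfold fconst. ring. }
  rewrite (G1 x y Hx), (G2 x y Hx). unfold slant_model, fmul, fconst, xi, fun_of_x.
  destruct i, j; rewrite ?A, ?B; field; lra.
Qed.

(** On [N3] ([e = -1]) and [N4] ([e = 1]) the Ricci tensor is minus the metric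
    [x ^ -2 (dx ^ 2 + e dy ^ 2)].  Equating mixed third derivatives of [f] gives
    [(mu + 1) df = 0]. *)
Lemma metric_integrability (mu e : R) (f : scalar_field) (x y : R) :
  smooth f -> quasi_einstein mu (diag_model (-1) (-1) e) f -> 0 < x ->
  (mu + 1) * pd i2 f x y = 0 /\ e * ((mu + 1) * pd i1 f x y) = 0.
Proof.
  intros Hf H Hx.
  assert (E11 := H i1 i1 x y Hx). assert (E12 := H i1 i2 x y Hx).
  assert (E22 := H i2 i2 x y Hx).
  assert (P211 := quasi_einstein_pd mu _ f i2 i1 i1 x y Hf H Hx).
  assert (P112 := quasi_einstein_pd mu _ f i1 i1 i2 x y Hf H Hx).
  assert (P212 := quasi_einstein_pd mu _ f i2 i1 i2 x y Hf H Hx).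
  assert (P122 := quasi_einstein_pd mu _ f i1 i2 i2 x y Hf H Hx).
  rewrite !ricci_sym_const_metric in *. unfold sum2, diag_model in *.
  rewrite !pd1_coord_x in *. rewrite !pd2_coord_x in *.
  rewrite (pd_swap3 i2 i1 i1 f Hf x y Hx) in P211.
  rewrite (pd_swap i2 i1) in P212 by auto with smooth.
  rewrite <- (pd_swap i1 i2 f Hf x y Hx) in *.
  set (f1 := pd i1 f x y) in *. set (f2 := pd i2 f x y) in *.
  set (f11 := pd i1 (pd i1 f) x y) in *. set (f12 := pd i1 (pd i2 f) x y) in *.
  set (f22 := pd i2 (pd i2 f) x y) in *.
  assert (S12 : x * f12 = - f2) by (apply Rmult_eq_reg_l with x; lra).
  split; [lra|].
  apply Rmult_eq_reg_l with x; [|lra].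
  apply (f_equal (Rmult x)) in P212. apply (f_equal (Rmult x)) in P122.
  apply (f_equal (Rmult e)) in E11. lra.
Qed.

Lemma metric_constant (mu e : R) (f : scalar_field) :
  e <> 0 -> mu <> -1 -> smooth f ->
  quasi_einstein mu (diag_model (-1) (-1) e) f -> exists c, half_eq f (fconst c).
Proof.
  intros He Hmu Hf H. apply constant_of_gradient; auto; intros x y Hx;
    destruct (metric_integrability mu e f x y Hf H Hx) as [E2 E1]; unfold fconst.
  - apply Rmult_integral in E1. destruct E1 as [E1|E1]; [contradiction|].
    apply Rmult_eq_reg_l with (mu + 1); lra.
  - apply Rmult_eq_reg_l with (mu + 1); lra.
Qed.

(** For [mu = -1] the product [h = x f] satisfies [h_xy = 0], [x h_xx = h_x] and
    [x h_yy = e h_x], so [h_x] is a constant multiple of [x] and [h] is a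
    quadratic polynomial. *)
Lemma metric_special (e : R) (f : scalar_field) :
  smooth f -> quasi_einstein (-1) (diag_model (-1) (-1) e) f ->
  exists c0 c1 k, forall x y, 0 < x ->
    x * f x y = c0 + c1 * y + k * (x ^ 2 + e * y ^ 2).
Proof.
  intros Hf H. set (h := fmul coord_x f).
  set (xi := fun_of_x Rinv). assert (Si : smooth xi) by exact smooth_inv.
  assert (I1 : forall x y, 0 < x ->
    pd i1 xi x y = - (xi x y * xi x y)) by exact pd1_inv.
  assert (I2 : forall x y, pd i2 xi x y = 0) by exact (pd2_fun_of_x Rinv).
  assert (Sh : smooth h) by (unfold h; auto with smooth).
  assert (G1 : half_eq (pd i1 h) (fadd f (fmul coord_x (pd i1 f)))).
  { intros x y Hx. unfold h. pd_push. unfold fadd, fmul. ring. }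
  assert (G2 : half_eq (pd i2 h) (fmul coord_x (pd i2 f))).
  { intros x y Hx. unfold h. pd_push. unfold fadd, fmul. ring. }
  assert (S12 : forall x y, 0 < x -> x * pd i1 (pd i2 f) x y = - pd i2 f x y).
  { intros x y Hx. assert (E12 := H i1 i2 x y Hx).
    rewrite ricci_sym_const_metric in E12. unfold sum2, diag_model in E12.
    apply Rmult_eq_reg_l with x; lra. }
  destruct (constant_of_gradient (fmul xi (pd i1 h))) as [k Hk];
    auto with smooth.
  - intros x y Hx. pd_push. rewrite (I1 x y Hx).
    rewrite (pd_ext i1 _ _ G1 x y Hx), (G1 x y Hx). pd_push.
    assert (E11 := H i1 i1 x y Hx). rewrite ricci_sym_const_metric in E11.
    unfold sum2, diag_model in E11.
    unfold fadd, fmul, fconst, xi, fun_of_x, coord_x.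
    replace (pd i1 (pd i1 f) x y) with ((f x y - x * pd i1 f x y) / x ^ 2)
      by (apply Rmult_eq_reg_l with (x ^ 2); [|apply pow_nonzero; lra];
          rewrite E11; field; lra).
    field. lra.
  - intros x y Hx. pd_push. rewrite I2.
    rewrite (pd_ext i2 _ _ G1 x y Hx). pd_push.
    rewrite <- (pd_comm f Hf x y Hx).
    change (coord_x x y) with x. rewrite S12 by auto. unfold fconst. ring.
  - assert (H1 : forall x y, 0 < x -> pd i1 h x y = k * x).
    { intros x y Hx. assert (E := Hk x y Hx).
      unfold fmul, fconst, xi, fun_of_x in E. rewrite <- E. field. lra. }
    destruct (affine_in_y (fadd h (fadd
        (fmul (fconst (- k / 2)) (fmul coord_x coord_x))
        (fmul (fconst (- e * k / 2)) (fmul coord_y coord_y)))))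
      as (c0 & c1 & E).
    + auto 10 with smooth.
    + intros x y Hx. pd_push. rewrite H1 by auto.
      unfold fmul, fconst, coord_x, coord_y. field.
    + assert (Z : half_eq (pd i2 (fadd h (fadd
        (fmul (fconst (- k / 2)) (fmul coord_x coord_x))
        (fmul (fconst (- e * k / 2)) (fmul coord_y coord_y)))))
        (fadd (fmul coord_x (pd i2 f)) (fmul (fconst (- e * k)) coord_y))).
      { intros x y Hx. pd_push. rewrite (G2 x y Hx).
        unfold fadd, fmul, fconst. field. }
      intros x y Hx. rewrite (pd_ext i2 _ _ Z x y Hx). pd_push.
      assert (E22 := H i2 i2 x y Hx). rewrite ricci_sym_const_metric in E22.
      unfold sum2, diag_model in E22.
      assert (A := H1 x y Hx). rewrite (G1 x y Hx) in A.
      unfold fadd, fmul, fconst, coord_x in *.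
      apply (f_equal (Rmult e)) in A.
      apply Rmult_eq_reg_l with x; lra.
    + exists c0, c1, (k / 2). intros x y Hx. assert (Q := E x y Hx).
      unfold h, fadd, fmul, fconst, coord_x, coord_y in Q. lra.
Qed.

Lemma metric_special_converse (e c0 c1 k : R) (f : scalar_field) :
  (forall x y, 0 < x -> f x y = / x * (c0 + c1 * y + k * (x ^ 2 + e * y ^ 2))) ->
  smooth f /\ quasi_einstein (-1) (diag_model (-1) (-1) e) f.
Proof.
  intros Hf.
  set (xi := fun_of_x Rinv). assert (Si : smooth xi) by exact smooth_inv.
  set (h := fadd (fadd (fconst c0) (fmul (fconst c1) coord_y))
    (fmul (fconst (k * e)) (fmul coord_y coord_y))).
  set (g := fadd (fmul xi h) (fmul (fconst k) coord_x)).
  assert (Sh : smooth h) by (unfold h; auto 10 with smooth).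
  assert (Sg : smooth g) by (unfold g; auto 10 with smooth).
  assert (E : half_eq g f).
  { intros x y Hx. rewrite (Hf x y Hx).
    unfold g, h, xi, fadd, fmul, fconst, fun_of_x, coord_x, coord_y. field. lra. }
  split; [now apply smooth_ext with g|]. apply quasi_einstein_ext with g; auto.
  assert (I1 : forall x y, 0 < x ->
    pd i1 xi x y = - (xi x y * xi x y)) by exact pd1_inv.
  assert (I2 : forall x y, pd i2 xi x y = 0) by exact (pd2_fun_of_x Rinv).
  assert (h1 : half_eq (pd i1 h) (fconst 0)).
  { intros x y Hx. unfold h. pd_push. unfold fconst. ring. }
  set (h' := fadd (fconst c1) (fmul (fconst (2 * k * e)) coord_y)).
  assert (Sh' : smooth h') by (unfold h'; auto 10 with smooth).
  assert (h2 : half_eq (pd i2 h) h').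
  { intros x y Hx. unfold h, h'. pd_push. unfold fadd, fmul, fconst. ring. }
  assert (G1 : half_eq (pd i1 g)
    (fadd (fmul (fconst (-1)) (fmul (fmul xi xi) h)) (fconst k))).
  { intros x y Hx. unfold g. pd_push. rewrite (I1 x y Hx), (h1 x y Hx).
    unfold fadd, fmul, fconst. ring. }
  assert (G2 : half_eq (pd i2 g) (fmul xi h')).
  { intros x y Hx. unfold g. pd_push. rewrite I2, (h2 x y Hx).
    unfold fadd, fmul, fconst. ring. }
  intros i j x y Hx. rewrite ricci_sym_const_metric. unfold sum2.
  assert (A : forall i, pd i (pd i1 g) x y = match i with
    | i1 => 2 * (/ x) ^ 3 * h x y | i2 => - (/ x) ^ 2 * h' x y end).
  { intros l. rewrite (pd_ext l _ _ G1 x y Hx). destruct l; pd_push.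
    - rewrite (I1 x y Hx), (h1 x y Hx). unfold fmul, fconst, xi, fun_of_x. ring.
    - rewrite I2, (h2 x y Hx). unfold fmul, fconst, xi, fun_of_x. ring. }
  assert (B : forall i, pd i (pd i2 g) x y = match i with
    | i1 => - (/ x) ^ 2 * h' x y | i2 => / x * (2 * k * e) end).
  { intros l. rewrite (pd_ext l _ _ G2 x y Hx). destruct l; pd_push.
    - rewrite (I1 x y Hx). unfold h'. pd_push.
      unfold fadd, fmul, fconst, xi, fun_of_x. ring.
    - rewrite I2. unfold h'. pd_push.
      unfold fadd, fmul, fconst, xi, fun_of_x. ring. }
  rewrite (G1 x y Hx), (G2 x y Hx).
  destruct i, j; rewrite ?A, ?B; unfold diag_model, g, h, h', fadd, fmul, fconst,
    xi, fun_of_x, coord_x, coord_y; field; lra.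
Qed.

Lemma N1_qe_space (r : R) : r <> 0 ->
  same_space (qe_space (- (1 / 4)) (typeB (slant_model 0 r))) N1_space.
Proof.
  intros Hr f. rewrite qe_space_typeB. split.
  - intros [Hf H]. now apply slant_upright_special with r.
  - apply N1_space_quasi_einstein.
Qed.

Lemma N3_qe_space : same_space (qe_space (-1) (typeB N3)) N3_space.
Proof.
  intros f. rewrite qe_space_typeB. split.
  - intros [Hf H]. destruct (metric_special (-1) f Hf H) as (c0 & c1 & k & E).
    exists (fun l => match l with 0%nat => c0 | 1%nat => c1 | _ => - k end).
    intros x y Hx. unfold rsum. simpl.
    apply Rmult_eq_reg_l with x; [|lra]. rewrite E by auto. field. lra.
  - intros Hf. apply Span_three in Hf. destruct Hf as (c0 & c1 & c2 & E).
    apply (metric_special_converse (-1) c0 c1 (- c2)). intros x y Hx.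
    rewrite (E x y Hx). unfold fadd, fmul, fconst. ring.
Qed.

Lemma N4_qe_space : same_space (qe_space (-1) (typeB N4)) N4_space.
Proof.
  intros f. rewrite qe_space_typeB. split.
  - intros [Hf H]. destruct (metric_special 1 f Hf H) as (c0 & c1 & k & E).
    exists (fun l => match l with 0%nat => c0 | 1%nat => c1 | _ => k end).
    intros x y Hx. unfold rsum. simpl.
    apply Rmult_eq_reg_l with x; [|lra]. rewrite E by auto. field. lra.
  - intros Hf. apply Span_three in Hf. destruct Hf as (c0 & c1 & c2 & E).
    apply (metric_special_converse 1 c0 c1 c2). intros x y Hx.
    rewrite (E x y Hx). unfold fadd, fmul, fconst. ring.
Qed.

Lemma qe_space_lin_iso (mu a b : R) (C D : idx -> idx -> idx -> R)
    (V : scalar_field -> Prop) :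
  lin_iso a b C D -> same_space (qe_space mu (typeB D)) V ->
  same_space (qe_space mu (typeB C)) (pullback a b V).
Proof.
  intros HI HV f. apply lin_iso_shear_related in HI. destruct HI as [Hb H].
  rewrite (qe_space_shear mu a b C D f Hb H).
  split; intros (g & Hg & E); exists g; split; auto; now apply HV.
Qed.

(** The pairs [(mu, D)] for which a normal form has non-constant solutions. *)
Definition exceptional (mu : R) (D : idx -> idx -> idx -> R) : Prop :=
  (mu = -1 /\ (D = N3 \/ D = N4)) \/
  (mu = - (1 / 4) /\ (D = N1_plus \/ D = N1_minus)).

Lemma normal_form_constant (mu : R) (D : idx -> idx -> idx -> R)
    (f : scalar_field) :
  normal_form D -> ~ exceptional mu D -> qe_space mu (typeB D) f ->
  exists c, half_eq f (fconst c).
Proof.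
  intros HD Hne Hf. apply qe_space_typeB in Hf. destruct Hf as [Hf H].
  unfold exceptional in Hne. destruct HD.
  - apply (metric_constant mu (-1)); auto; lra || tauto.
  - apply (metric_constant mu 1); auto; lra || tauto.
  - rewrite <- slant_model_N1_plus in *.
    apply (slant_upright_constant mu (- (1 / 2))); auto; lra || tauto.
  - rewrite <- slant_model_N1_minus in *.
    apply (slant_upright_constant mu (1 / 2)); auto; lra || tauto.
  - now apply (slant_skew_constant mu r).
Qed.

(** Non-zero constants are never solutions in the exceptional cases. *)
Lemma exceptional_ricci (mu : R) (D : idx -> idx -> idx -> R) :
  exceptional mu D -> mu <> 0 /\ exists i j, ricci_sym_const D i j <> 0.
Proof.
  intros [[E [H|H]]|[E [H|H]]]; rewrite E, H; (split; [lra|]).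
  - exists i1, i1. unfold N3. rewrite ricci_sym_const_metric. lra.
  - exists i1, i1. unfold N4. rewrite ricci_sym_const_metric. lra.
  - exists i2, i2. rewrite <- slant_model_N1_plus, ricci_sym_const_slant. lra.
  - exists i2, i2. rewrite <- slant_model_N1_minus, ricci_sym_const_slant. lra.
Qed.

Lemma qe_space_constant (mu : R) (C : idx -> idx -> idx -> R) (c : R)
    (f : scalar_field) : half_eq f (fconst c) ->
  qe_space mu (typeB C) f <-> forall i j, mu * ricci_sym_const C i j * c = 0.
Proof.
  intros E.
  assert (Z1 : forall i, half_eq (pd i f) (fconst 0)).
  { intros i x y Hx. rewrite (pd_ext i _ _ E x y Hx). apply pd_const. }
  assert (Z2 : forall i j x y, 0 < x -> pd i (pd j f) x y = 0).
  { intros i j x y Hx. rewrite (pd_ext i _ _ (Z1 j) x y Hx). apply pd_const. }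
  rewrite qe_space_typeB. split.
  - intros [_ H] i j. assert (K := H i j 1 0 Rlt_0_1). unfold sum2 in K.
    assert (Hlt : 0 < 1) by lra.
    rewrite Z2, !(Z1 _ 1 0 Hlt), (E 1 0 Hlt) in K by auto. unfold fconst in K. lra.
  - intros H. split.
    + apply smooth_ext with (fconst c); [now apply half_eq_sym | apply smooth_const].
    + intros i j x y Hx. unfold sum2.
      rewrite Z2, !(Z1 _ x y Hx), (E x y Hx) by auto. unfold fconst.
      rewrite (H i j). ring.
Qed.

Lemma one_space_constant (f : scalar_field) :
  one_space f <-> exists c, half_eq f (fconst c).
Proof.
  split.
  - intros [c Hc]. exists (c 0%nat). intros x y Hx. rewrite (Hc x y Hx).
    unfold rsum, fconst. simpl. ring.
  - intros [c Hc]. exists (fun _ => c). intros x y Hx. rewrite (Hc x y Hx).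
    unfold rsum, fconst. simpl. ring.
Qed.

Theorem theorem4p4
  (C : idx -> idx -> idx -> R) (HC : forall i j k, C i j k = C j i k)
  (Hdim : killing_dim (typeB C) 3) (mu : R) :
  (mu = 0 \/ ricci_sym_zero (typeB C) ->
     same_space (qe_space mu (typeB C)) one_space) /\
  (forall a b : R, lin_iso a b C N3 -> mu = -1 ->
     same_space (qe_space mu (typeB C)) (pullback a b N3_space)) /\
  (forall a b : R, lin_iso a b C N4 -> mu = -1 ->
     same_space (qe_space mu (typeB C)) (pullback a b N4_space)) /\
  (forall a b : R, lin_iso a b C N1_plus \/ lin_iso a b C N1_minus ->
     mu = - (1 / 4) ->
     same_space (qe_space mu (typeB C)) (pullback a b N1_space)) /\
  (~ (mu = 0 \/ ricci_sym_zero (typeB C)) ->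
   ~ (lin_isomorphic C N3 /\ mu = -1) ->
   ~ (lin_isomorphic C N4 /\ mu = -1) ->
   ~ ((lin_isomorphic C N1_plus \/ lin_isomorphic C N1_minus) /\
        mu = - (1 / 4)) ->
     same_space (qe_space mu (typeB C)) zero_space).
Proof.
  destruct (killing_dim3_normal_form C HC Hdim) as (D & a & b & HD & Hb & HCD).
  assert (Iso : lin_iso a b C D) by now apply lin_iso_shear_related.
  assert (Const : ~ exceptional mu D -> forall f, qe_space mu (typeB C) f ->
    exists c, half_eq f (fconst c)).
  { intros Hne f Hf. apply (qe_space_shear mu a b C D f Hb HCD) in Hf.
    destruct Hf as (g & Hg & E).
    destruct (normal_form_constant mu D g HD Hne Hg) as [c Hc].
    exists c. intros x y Hx. rewrite (E x y Hx).
    exact (Hc x (a * x + b * y) Hx). }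
  split; [|split; [|split; [|split]]].
  - intros H0.
    assert (Z : forall i j c, mu * ricci_sym_const C i j * c = 0).
    { intros i j c. destruct H0 as [H0|H0]; [rewrite H0; ring|].
      rewrite ricci_sym_zero_typeB in H0. rewrite H0. ring. }
    assert (Hne : ~ exceptional mu D).
    { intros HE. destruct (exceptional_ricci mu D HE) as [Hmu (i & j & Hij)].
      destruct H0 as [H0|H0]; [contradiction|]. apply Hij.
      rewrite ricci_sym_zero_typeB in H0.
      rewrite (ricci_sym_const_shear (- a / b) (/ b) D C);
        auto using Rinv_neq_0_compat, shear_related_inverse.
      unfold sum2. rewrite !H0. ring. }
    intros f. rewrite one_space_constant. split; [now apply Const|].
    intros [c Hc]. now apply (qe_space_constant mu C c f Hc).
  - intros a' b' HI Hmu. rewrite Hmu.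
    exact (qe_space_lin_iso _ _ _ _ _ _ HI N3_qe_space).
  - intros a' b' HI Hmu. rewrite Hmu.
    exact (qe_space_lin_iso _ _ _ _ _ _ HI N4_qe_space).
  - intros a' b' HI Hmu. rewrite Hmu.
    rewrite <- slant_model_N1_plus, <- slant_model_N1_minus in HI.
    destruct HI as [HI|HI]; apply (qe_space_lin_iso _ _ _ _ _ _ HI);
      apply N1_qe_space; lra.
  - intros H0 H3 H4 H1.
    assert (Hne : ~ exceptional mu D).
    { unfold exceptional.
      intros [[E [H|H]]|[E [H|H]]]; rewrite H in Iso;
        [apply H3 | apply H4 | apply H1 | apply H1]; split; auto;
        [exists a, b | exists a, b | left; exists a, b | right; exists a, b];
        exact Iso. }
    intros f. split.
    + intros Hf. destruct (Const Hne f Hf) as [c Hc].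
      assert (Z := proj1 (qe_space_constant mu C c f Hc) Hf).
      intros x y Hx. rewrite (Hc x y Hx). unfold fconst.
      destruct (Req_dec c 0) as [E|N]; auto. exfalso. apply H0.
      destruct (Req_dec mu 0) as [Emu|Nmu]; [now left|right].
      apply ricci_sym_zero_typeB. intros i j.
      apply Rmult_eq_reg_l with (mu * c); [|now apply Rmult_integral_contrapositive].
      specialize (Z i j). lra.
    + intros Hz. apply (qe_space_constant mu C 0 f Hz). intros i j. ring.
Qed.
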